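(* Let $\alpha>-1$, let $k\ge 2$ be an integer, and let $n\ge 0$ be an integer. Let $\varphi(z)=\sum_{i=-n}^{n} a_i \dfrac{z^i}{\gamma_i}$ and $\psi(z)=\sum_{j=-n}^{n} b_j \dfrac{z^j}{\gamma_j}$ be bounded harmonic functions on $\mathbb{D}$ with complex coefficients, where $a_n\neq 0$ and $b_n\neq 0$, and where for $i<0$ the symbol $z^{i}/\gamma_i$ means $\overline{z}^{|i|}/\gamma_{|i|}$. Then the $k$-th order slant Toeplitz operators $\mathcal{B}_{\varphi}^{k,\alpha}$ and $\mathcal{B}_{\psi}^{k,\alpha}$ on $\mathcal{A}_\alpha^2(\mathbb{D})$ commute if and only if $\varphi$ and $\psi$ are linearly dependent.
   Context: $\mathbb{D}$ is the open unit disc in $\mathbb{C}$, $dA$ the normalized area measure on $\mathbb{D}$, and for $\alpha>-1$, $dA_\alpha(z)=(1+\alpha)(1-|z|^2)^\alpha dA(z)$. $\mathcal{A}_\alpha^2(\mathbb{D})$ is the weighted Bergman space: the closed subspace of analytic functions in $\mathcal{L}^2_\alpha(\mathbb{D})=L^2(\mathbb{D},dA_\alpha)$, with the inner product $\langle f,g\rangle=\int_{\mathbb{D}} f\overline{g}\,dA_\alpha$. It has orthonormal basis $e_m(z)=z^m/\gamma_m$, $m\ge 0$, where $\gamma_m=\sqrt{\Gamma(m+1)\Gamma(\alpha+2)/\Gamma(m+\alpha+2)}$. $P_\alpha$ is the orthogonal projection of $\mathcal{L}^2_\alpha(\mathbb{D})$ onto $\mathcal{A}_\alpha^2(\mathbb{D})$.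 For bounded measurable $\phi$, the Toeplitz operator is $\mathcal{T}_\phi^\alpha f=P_\alpha(\phi f)$ on $\mathcal{A}_\alpha^2(\mathbb{D})$. For an integer $k\ge 2$, $W_k$ is the bounded linear operator on $\mathcal{A}_\alpha^2(\mathbb{D})$ with $W_k e_m=z^{m/k}/\gamma_{m/k}$ if $k\mid m$ and $W_k e_m=0$ otherwise. The $k$-th order slant Toeplitz operator is $\mathcal{B}_\phi^{k,\alpha}=W_k\mathcal{T}_\phi^\alpha$. *)

(* Defs.v *)
From HB Require Import structures.
From mathcomp Require Import all_boot all_order all_algebra.
From mathcomp Require Import complex.
From mathcomp Require Import all_classical all_reals all_analysis.

Set Implicit Arguments.
Unset Strict Implicit.
Unset Printing Implicit Defensive.

Import Order.TTheory GRing.Theory Num.Theory.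
Import numFieldNormedType.Exports.

Local Open Scope classical_set_scope.
Local Open Scope ring_scope.

(* Functions on the unit disc are represented by total functions R[i] -> R[i];
   elements of the Bergman space are required to vanish off the disc, so that
   Leibniz equality of representatives is equality on the disc. *)

Section Bergman.
Context {R : realType}.
Local Notation C := R[i].

Definition unit_disc : set C := [set z | `|z| < 1].

(* R[i] carries no measurable structure: integrals over the disc are taken over
   the corresponding subset of R * R. *)
Definition of_plane (p : R * R) : C := Complex p.1 p.2.

Definition plane_disc : set (R * R) := of_plane @^-1` unit_disc.

Definition plane_measure := (@lebesgue_measure R \x @lebesgue_measure R)%E.

(* Density of dA_alpha with respect to Lebesgue measure on the plane; the factor
   1 / pi comes from the normalization of the area measure dA. *)
Definition dA_density (alpha : R) (z : C) : R :=
  (1 + alpha) * (1 - complex.Re `|z| ^+ 2) `^ alpha / pi.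

Definition disc_integral (alpha : R) (F : C -> C) : C :=
  Complex
    (\int[plane_measure]_(p in plane_disc)
       (complex.Re (F (of_plane p)) * dA_density alpha (of_plane p)))
    (\int[plane_measure]_(p in plane_disc)
       (complex.Im (F (of_plane p)) * dA_density alpha (of_plane p))).

Definition inner (alpha : R) (f g : C -> C) : C :=
  disc_integral alpha (fun z => f z * conjc (g z)).

Definition norm2 (alpha : R) (f : C -> C) : R :=
  Num.sqrt (complex.Re (inner alpha f f)).

Definition L2 (alpha : R) (f : C -> C) : Prop :=
  [/\ measurable_fun plane_disc (fun p => complex.Re (f (of_plane p))),
      measurable_fun plane_disc (fun p => complex.Im (f (of_plane p))) &
      (\int[plane_measure]_(p in plane_disc)
         (complex.Re `|f (of_plane p)| ^+ 2
            * dA_density alpha (of_plane p))%:E < +oo)%E].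

(* Complex differentiability: the field of scalars is R[i] itself. *)
Definition analytic_on_disc (f : C -> C) : Prop :=
  forall z, unit_disc z -> derivable (f : C^o -> C^o) z 1.

Definition bergman (alpha : R) : set (C -> C) :=
  [set f | [/\ forall z, ~ unit_disc z -> f z = 0, analytic_on_disc f & L2 alpha f]].

Definition bergman_proj (alpha : R) (g : C -> C) : C -> C :=
  xget (fun=> 0) [set h | bergman alpha h /\
    forall f, bergman alpha f -> inner alpha (fun z => g z - h z) f = 0].

Definition toeplitz (alpha : R) (phi f : C -> C) : C -> C :=
  bergman_proj alpha (fun z => phi z * f z).

Definition Gamma (x : R) : R :=
  \int[@lebesgue_measure R]_(t in `]0, +oo[) (t `^ (x - 1) * expR (- t)).

Definition gamma (alpha : R) (m : nat) : R :=
  Num.sqrt (Gamma (m%:R + 1) * Gamma (alpha + 2) / Gamma (m%:R + alpha + 2)).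

(* z^i / gamma_i, with the convention conj(z)^|i| / gamma_|i| for i < 0. *)
Definition harmonic_monomial (alpha : R) (i : int) (z : C) : C :=
  match i with
  | Posz m => z ^+ m
  | Negz m => conjc z ^+ m.+1
  end / real_complex R (gamma alpha `|i|%N).

Definition bergman_basis (alpha : R) (m : nat) : C -> C :=
  fun z => if `|z| < 1 then z ^+ m / real_complex R (gamma alpha m) else 0.

Definition bounded_linear (alpha : R) (T : (C -> C) -> (C -> C)) : Prop :=
  [/\ forall f, bergman alpha f -> bergman alpha (T f),
      forall (c : C) f g, bergman alpha f -> bergman alpha g ->
        T (fun z => c * f z + g z) = (fun z => c * T f z + T g z) &
      exists M : R, forall f, bergman alpha f ->
        norm2 alpha (T f) <= M * norm2 alpha f].

(* The defining properties of W_k, which determine it on the Bergman space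
   because the span of the e_m is dense there. *)
Definition is_slant_shift (alpha : R) (k : nat) (W : (C -> C) -> (C -> C)) :
    Prop :=
  bounded_linear alpha W /\
  forall m, W (bergman_basis alpha m) =
    if (k %| m)%N then bergman_basis alpha (m %/ k)%N else fun=> 0.

Definition slant_toeplitz (alpha : R) (W : (C -> C) -> (C -> C))
    (phi f : C -> C) : C -> C :=
  W (toeplitz alpha phi f).

(* sum over - n <= i <= n of a_i z^i / gamma_i *)
Definition harmonic_poly (alpha : R) (n : nat) (a : int -> C) (z : C) : C :=
  \sum_(j < (n.*2).+1) a (j%:Z - n%:Z) * harmonic_monomial alpha (j%:Z - n%:Z) z.

Definition linearly_dependent (f g : C -> C) : Prop :=
  exists c d : C, (c, d) != (0, 0) /\
    forall z, unit_disc z -> c * f z + d * g z = 0.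

End Bergman.

(* Main.v *)
(* On monomials the Toeplitz operator with symbol [phi] acts by
   [z^m |-> sum_i (a_i / gamma_|i|) tau(i, m) z^(m + i)] with [tau(i, m) > 0]
   as soon as [m >= n]: for [i >= 0] the product is already analytic, and for
   [i < 0] one has to show that [zbar^i z^m] projects onto a positive multiple of
   [z^(m - i)].  This amounts to the proportionality, for [f] in the Bergman
   space, of the integrals of [f zbar^l |z|^(2i)] and [f zbar^l].  It is proved
   without power series: if [L] is a primitive of [u^l (1 - u)^alpha chi(u)]
   with [chi] supported in (0, 1) and [L(1) = 0], then
   [f zbar^l (1 - |z|^2)^alpha chi(|z|^2)] is the dbar-derivative of the compactly
   supported function [f z^(-l-1) L(|z|^2)], hence has integral zero; Goursat's
   bisection proves this with no continuity assumption on the derivative of [f].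

   If the two operators commute, subtract from [psi] the multiple of [phi] that
   cancels the coefficient of index [n].  If the difference were nonzero with top
   index [t < n], then for [m = k^2 p - k n - t] with [p] large one product would
   send [z^m] to a polynomial of degree [p] and the other to one of lower degree.
   Conversely, the projection of [c g] is [c] times that of [g], so that
   proportional symbols give commuting operators. *)
Require Import Defs.
From mathcomp Require Import all_boot all_order all_algebra.
From mathcomp Require Import complex lra ring zify.
From mathcomp Require Import all_classical all_reals all_analysis.
From mathcomp Require Import measurable_realfun.
Set Implicit Arguments.
Unset Strict Implicit.
Unset Printing Implicit Defensive.
Import Order.TTheory GRing.Theory Num.Theory.
Import numFieldNormedType.Exports.
Local Open Scope classical_set_scope.
Local Open Scope ring_scope.

(** * Divergence theorem for differentiable fields *)

(** [bergman_proj] is a choice with default value 0, and the existence of the projection of an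
    arbitrary square-integrable function is never established. In the direct implication projections
    are therefore exhibited: [is_proj] carries the projected function as a witness, and Toeplitz
    operators are computed on polynomials only.

    The other obstacle is the weight. For [alpha < 0] it is unbounded at the boundary, so even the
    constant 1 has to be shown integrable. The dbar argument serves here too: for [f = 1] it makes
    the area integral of a radial cutoff proportional to a one-dimensional moment, which is at most
    [1 / (1 + alpha)]. This takes the place of polar coordinates.

    The degree count at the end rests on [k >= 2]. With [m + t = k M] and [M + n = k p], taking the
    index [t] first and [n] second leads from [z^m] exactly to [z^p]. In the other order the first
    step gains [n - t], but this gain is divided by [k] before the second step loses [n - t], so
    [k p] is missed. *)

Section Goursat.
Context {R : realType}.
Implicit Types (P Q : R -> R -> R) (D : R * R -> R).
Local Notation lam := (@lebesgue_measure R).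
Local Notation pm := (@plane_measure R).
(* The measurable structure carried by [plane_measure]: the canonical one on
   [R * R] has the same measurable sets but another display. *)
Local Notation T2 := (measurableTypeR R * measurableTypeR R)%type.

(** Caratheodory's form of differentiability at [(x0, y0)] with partial derivatives [a] and [b]; it
    says nothing about derivatives at other points, as Goursat's argument demands. Closed boxes
    replace neighbourhood filters because the estimates are made on small squares. *)
Definition slopes P (x0 y0 a b : R) := exists p1 p2 : R -> R -> R,
  (forall x y, P x y = P x0 y0 + p1 x y * (x - x0) + p2 x y * (y - y0)) /\
  forall e, 0 < e -> exists2 d, 0 < d & forall x y,
    `|x - x0| <= d -> `|y - y0| <= d ->
    `|p1 x y - a| <= e /\ `|p2 x y - b| <= e.

(** Half-open, so that bisection gives an exact partition and no null edges have to be discarded. *)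
Definition rect (a b c d : R) : set (R * R) := `[a, b[%classic `*` `[c, d[%classic.

Lemma measurable_rect a b c d : measurable (rect a b c d : set T2).
Proof. exact: measurableX. Qed.

Lemma slopes_continuous_r P x0 : (forall y0, exists a b, slopes P x0 y0 a b) ->
  continuous (P x0).
Proof.
move=> h y0; have [a [b [p1 [p2 [Pe cv]]]]] := h y0.
apply/cvgrPdist_le => e e0.
have [d d0 Hd] := cv 1 ltr01.
have b0 : 0 < `|b| + 1 by rewrite ltr_wpDl.
have m0 : 0 < Num.min d (e / (`|b| + 1)) by rewrite lt_min d0 divr_gt0.
near=> y.
have yd : `|y - y0| <= Num.min d (e / (`|b| + 1)).
  rewrite distrC; near: y; exact: cvgr_dist_le.
move: yd; rewrite le_min => /andP[yd ye].
rewrite [P x0 y]Pe subrr mulr0 addr0 opprD addrA subrr add0r normrN normrM.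
have [_ p2b] := Hd x0 y (eq_ind_r (fun z => `|z| <= d) (eq_ind_r (fun z => z <= d) (ltW d0) (normr0 _)) (subrr x0)) yd.
have p2le : `|p2 x0 y| <= `|b| + 1.
  by rewrite -(subrK b (p2 x0 y)) addrC (le_trans (ler_normD _ _))// lerD2l.
by rewrite (le_trans (ler_pM _ _ p2le ye))// mulrC divfK// gt_eqF.
Unshelve. all: by end_near. Qed.

Lemma slopes_swap P x y a b : slopes P x y a b -> slopes (fun y x => P x y) y x b a.
Proof.
move=> [p1 [p2 [Pe cv]]]; exists (fun y x => p2 x y), (fun y x => p1 x y).
split=> [u v|e e0]; first by rewrite Pe addrAC.
have [d d0 Hd] := cv e e0; exists d => // u v ud vd.
by have [] := Hd v u vd ud.
Qed.

Lemma slopes_continuous_l P y0 : (forall x0, exists a b, slopes P x0 y0 a b) ->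
  continuous (P^~ y0).
Proof.
move=> h; apply: (@slopes_continuous_r (fun y x => P x y)) => x.
by have [a [b /slopes_swap ?]] := h x; exists b, a.
Qed.

Lemma integrable_itvco (f : R -> R) c d : continuous f ->
  lam.-integrable `[c, d[ (EFin \o f).
Proof.
move=> cf; apply: (@integrableS _ _ _ lam `[c, d]%classic) => //.
  by apply: subset_itvl; rewrite bnd_simp.
apply: continuous_compact_integrable; first exact: segment_compact.
by apply: continuous_subspaceT => x; exact: cf.
Qed.

Lemma itvco_setU (a m b : R) : a <= m -> m <= b ->
  `[a, b[%classic = `[a, m[%classic `|` `[m, b[%classic :> set R.
Proof. by move=> am mb; rewrite -itv_bndbnd_setU// bnd_simp. Qed.

Lemma itvco_disj (a m b : R) : [disjoint `[a, m[%classic & `[m, b[%classic].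
Proof.
apply/disj_set2P; rewrite -subset0 => x /=; rewrite !in_itv/=.
by move=> [/andP[_ h1] /andP[h2 _]]; move: (lt_le_trans h1 h2); rewrite ltxx.
Qed.

Lemma Rintegral_itvco_split (f : R -> R) a m b : continuous f -> a <= m -> m <= b ->
  \int[lam]_(x in `[a, b[) f x =
  \int[lam]_(x in `[a, m[) f x + \int[lam]_(x in `[m, b[) f x.
Proof.
move=> cf am mb; rewrite (itvco_setU am mb) Rintegral_setU//.
  by rewrite -itvco_setU//; exact: integrable_itvco.
exact: itvco_disj.
Qed.

(** The defect in the divergence theorem for the field [(P, Q)] with divergence [D]: flux through
    the boundary minus the integral of [D]. It is additive under subdivision because the terms on a
    common edge cancel. *)
Definition flux P Q D a b c d :=
  \int[lam]_(y in `[c, d[) (P b y - P a y)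
  + \int[lam]_(x in `[a, b[) (Q x d - Q x c)
  - \int[pm]_(z in rect a b c d) D z.

Section flux.
Variables (P Q : R -> R -> R) (D : R * R -> R).
Hypothesis cP : forall x, continuous (P x).
Hypothesis cQ : forall y, continuous (Q^~ y).

Lemma contB (f g : R -> R) : continuous f -> continuous g ->
  continuous (fun x => f x - g x).
Proof. by move=> cf cg x; apply: cvgB; [exact: cf|exact: cg]. Qed.

Lemma flux_split_x a m b c d : a <= m -> m <= b ->
  pm.-integrable (rect a b c d) (EFin \o D) ->
  flux P Q D a b c d = flux P Q D a m c d + flux P Q D m b c d.
Proof.
move=> am mb iD; rewrite /flux.
have -> : \int[lam]_(y in `[c, d[) (P b y - P a y) =
  \int[lam]_(y in `[c, d[) (P m y - P a y) + \int[lam]_(y in `[c, d[) (P b y - P m y).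
  rewrite -RintegralD//; try by apply: integrable_itvco; apply: contB; exact: cP.
  by apply: eq_Rintegral => y _; ring.
rewrite (@Rintegral_itvco_split _ a m b)//; last by apply: contB; exact: cQ.
have re : rect a b c d = rect a m c d `|` rect m b c d.
  rewrite /rect (itvco_setU am mb); apply/seteqP; split=> -[x y] /=; tauto.
rewrite {1}re Rintegral_setU//; first ring.
- exact: measurable_rect.
- exact: measurable_rect.
- by rewrite -re.
- apply/disj_set2P; rewrite -subset0 => -[x y] [[/= h1 _] [/= h2 _]].
  by have /disj_set2P := itvco_disj a m b; rewrite -subset0; apply; split; [exact: h1|exact: h2].
Qed.

Lemma flux_split_y a b c m d : c <= m -> m <= d ->
  pm.-integrable (rect a b c d) (EFin \o D) ->
  flux P Q D a b c d = flux P Q D a b c m + flux P Q D a b m d.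
Proof.
move=> am mb iD; rewrite /flux.
have -> : \int[lam]_(x in `[a, b[) (Q x d - Q x c) =
  \int[lam]_(x in `[a, b[) (Q x m - Q x c) + \int[lam]_(x in `[a, b[) (Q x d - Q x m).
  rewrite -RintegralD//; try by apply: integrable_itvco; apply: contB; exact: cQ.
  by apply: eq_Rintegral => y _; ring.
rewrite (@Rintegral_itvco_split _ c m d)//; last by apply: contB; exact: cP.
have re : rect a b c d = rect a b c m `|` rect a b m d.
  rewrite /rect (itvco_setU am mb); apply/seteqP; split=> -[x y] /=; tauto.
rewrite {1}re Rintegral_setU//; first ring.
- exact: measurable_rect.
- exact: measurable_rect.
- by rewrite -re.
- apply/disj_set2P; rewrite -subset0 => -[x y] [[/= _ h1] [/= _ h2]].
  by have /disj_set2P := itvco_disj c m d; rewrite -subset0; apply; split; [exact: h1|exact: h2].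
Qed.
End flux.

Lemma lam_itvco (a b : R) : a <= b -> fine (lam `[a, b[%classic) = b - a.
Proof.
move=> ab; rewrite lebesgue_measure_itv/= lte_fin.
case: ltP => //= ba; have -> : b = a by apply/eqP; rewrite eq_le ba ab.
by rewrite subrr.
Qed.

Lemma lam_itvco_fin (a b : R) : (lam `[a, b[%classic < +oo)%E.
Proof. by rewrite lebesgue_measure_itv/=; case: ifP => _; rewrite ltry. Qed.

Lemma pm_rect a b c d : a <= b -> c <= d ->
  pm (rect a b c d) = ((b - a) * (d - c))%:E.
Proof.
move=> ab cd; rewrite /plane_measure /rect product_measure1E//=.
rewrite !lebesgue_measure_itv/= !lte_fin.
have E u v : u <= v -> (if u < v then (v - u)%:E else 0%E) = (v - u)%:E :> \bar R.
  by case: ltP => // vu uv; rewrite (_ : v = u) ?subrr//; apply/eqP; rewrite eq_le vu uv.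
by rewrite !EFinN -!EFinD !E// EFinM.
Qed.

Lemma bounded_integrable d (T : measurableType d) (mu : {measure set T -> \bar R})
  (A : set T) (f : T -> R) M :
  measurable A -> (mu A < +oo)%E -> measurable_fun A f ->
  (forall x, A x -> `|f x| <= M) -> mu.-integrable A (EFin \o f).
Proof.
move=> mA muA mf fM; apply: measurable_bounded_integrable => //.
exists M; split; first exact: num_real.
by move=> x Mx y Ay; apply: le_trans (ltW Mx); exact: fM.
Qed.

Lemma Rintegral_near_cst d (T : measurableType d) (mu : {measure set T -> \bar R})
  (A : set T) (f : T -> R) k e :
  measurable A -> (mu A < +oo)%E -> mu.-integrable A (EFin \o f) ->
  (forall x, A x -> `|f x - k| <= e) ->
  `|\int[mu]_(x in A) f x - k * fine (mu A)| <= e * fine (mu A).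
Proof.
move=> mA muA fi fk.
have ci r : mu.-integrable A (EFin \o (fun=> r)) by apply: (@bounded_integrable _ _ _ _ _ `|r|).
rewrite -!Rintegral_cst// -(RintegralB mA fi (ci k)).
rewrite (le_trans (le_normr_Rintegral _ _))//.
  have -> : EFin \o (fun t => f t - k) = (fun t => (EFin \o f) t - (EFin \o (fun=> k)) t)%E by [].
  by exact: (integrableB mA fi (ci k)).
apply: (le_Rintegral mA _ (ci e) fk).
have -> : EFin \o (fun t => `|f t - k|) = (fun t => `|(EFin \o f) t - (EFin \o (fun=> k)) t|)%E by [].
by apply: integrable_abse; exact: (integrableB mA fi (ci k)).
Qed.

Lemma dist_in_itv (a x y s : R) : a <= x <= a + s -> a <= y <= a + s -> `|x - y| <= s.
Proof. by move=> /andP[? ?] /andP[? ?]; rewrite ler_norml; apply/andP; split; lra. Qed.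

Lemma normr4_le (u1 plane_sqn u3 u4 k : R) : `|u1| <= k -> `|plane_sqn| <= k -> `|u3| <= k ->
  `|u4| <= k -> `|u1 + plane_sqn - u3 - u4| <= 4 * k.
Proof.
rewrite !ler_norml => /andP[? ?] /andP[? ?] /andP[? ?] /andP[? ?].
by apply/andP; split; lra.
Qed.

Lemma flux_error (I1 I2 I3 px qy s e : R) :
  `|I1 - px * s * s| <= 4 * (e / 9 * s) * s ->
  `|I2 - qy * s * s| <= 4 * (e / 9 * s) * s ->
  `|I3 - (px + qy) * (s * s)| <= e / 9 * (s * s) ->
  `|I1 + I2 - I3| <= e * s ^+ 2.
Proof.
rewrite !ler_norml => /andP[? ?] /andP[? ?] /andP[? ?].
by rewrite expr2; apply/andP; split; lra.
Qed.

Lemma half_in_itv (a s t l r : R) : l <= a -> a + s <= r -> t = s / 2 -> 0 < t ->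
  [/\ a <= a + t, l <= a + t, a + t <= r, a + t + t <= a + s & a + t + t <= r] /\
  a + t <= a + s.
Proof. by move=> *; split; [split|]; lra. Qed.

Lemma sum4_lt (E t x1 x2 x3 x4 y z w : R) :
  x1 < E * t -> x2 < E * t -> x3 < E * t -> x4 < E * t ->
  y <= x3 + x4 -> z <= x1 + x2 -> E * (4 * t) <= z + y -> False.
Proof. by move=> *; lra. Qed.

Section goursat.
Variables (P Q : R -> R -> R) (D : R * R -> R) (l h : R).
Hypothesis h0 : 0 < h.
Hypothesis sl : forall x y, exists px py qx qy,
  [/\ slopes P x y px py, slopes Q x y qx qy & px + qy = D (x, y)].
Hypothesis cD : forall x y e, 0 < e -> exists2 d, 0 < d & forall x' y',
  `|x' - x| <= d -> `|y' - y| <= d -> `|D (x', y') - D (x, y)| <= e.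
Hypothesis iD : pm.-integrable (rect l (l + h) l (l + h)) (EFin \o D).

Let cP x : continuous (P x).
Proof.
by apply: slopes_continuous_r => y; have [a [b [c [d [? _ _]]]]] := sl x y; exists a, b.
Qed.

Let cQ y : continuous (Q^~ y).
Proof.
by apply: slopes_continuous_l => x; have [a [b [c [d [_ ? _]]]]] := sl x y; exists c, d.
Qed.

Let phi a b s := flux P Q D a (a + s) b (b + s).

Let iDs a c s : 0 <= s -> l <= a -> a + s <= l + h -> l <= c -> c + s <= l + h ->
  pm.-integrable (rect a (a + s) c (c + s)) (EFin \o D).
Proof.
move=> s0 la ah lc ch; apply: integrableS iD; try exact: measurable_rect.
move=> [x y]; rewrite /rect/= => -[]; rewrite !in_itv/= => /andP[h1 h2] /andP[h3 h4].
by split; apply/andP; split; lra.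
Qed.

(** The linear parts of [P] and [Q] at the point contribute exactly [px * s ^+ 2] and [qy * s ^+ 2]
    to the boundary terms, and together these match [D (x0, y0) * s ^+ 2]. Only the errors of the
    slopes and of [D] remain. *)
Lemma flux_local x0 y0 e : 0 < e -> exists2 d, 0 < d & forall a c s,
  0 <= s -> s <= d -> a <= x0 <= a + s -> c <= y0 <= c + s ->
  l <= a -> a + s <= l + h -> l <= c -> c + s <= l + h ->
  `|phi a c s| <= e * s ^+ 2.
Proof.
(* Nine error terms share [e]: four slope errors for each of [P] and [Q], and one for the variation
   of [D]. *)
move=> e0; have e9 : 0 < e / 9 by rewrite divr_gt0.
have [px [py [qx [qy [[p1 [p2 [Pe Pc]]] [q1 [q2 [Qe Qc]]] pqD]]]]] := sl x0 y0.
have [d1 d10 H1] := Pc _ e9.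
have [d2 d20 H2] := Qc _ e9.
have [d3 d30 H3] := cD x0 y0 e9.
exists (Num.min d1 (Num.min d2 d3)); first by rewrite !lt_min d10 d20 d30.
move=> a c s s0; rewrite !le_min => /andP[sd1 /andP[sd2 sd3]] /andP[ax xa] /andP[cy yc] la ah lc ch.
have as_ : a <= a + s by lra.
have cs_ : c <= c + s by lra.
have nx x : a <= x <= a + s -> `|x - x0| <= s.
  by move=> xI; apply: (dist_in_itv xI); rewrite ax.
have ny y : c <= y <= c + s -> `|y - y0| <= s.
  by move=> xI; apply: (dist_in_itv xI); rewrite cy.
have aI : a <= a <= a + s by rewrite lexx.
have asI : a <= a + s <= a + s by rewrite lexx andbT.
have cI : c <= c <= c + s by rewrite lexx.
have csI : c <= c + s <= c + s by rewrite lexx andbT.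
have key (u v p : R) : `|u - p| <= e / 9 -> `|v| <= s -> `|(u - p) * v| <= e / 9 * s.
  by move=> ? ?; rewrite normrM ler_pM.
have EP : `|\int[lam]_(y in `[c, c + s[) (P (a + s) y - P a y) - px * s * s|
    <= 4 * (e / 9 * s) * s.
  have := @Rintegral_near_cst _ _ lam `[c, c + s[%classic
    (fun y => P (a + s) y - P a y) (px * s) (4 * (e / 9 * s)).
  rewrite lam_itvco// (_ : c + s - c = s); last ring.
  apply=> //.
  - exact: lam_itvco_fin.
  - by apply: integrable_itvco; apply: contB; exact: cP.
  move=> y /=; rewrite in_itv/= => /andP[y1 y2].
  have /ny ys : c <= y <= c + s by rewrite y1 ltW.
  have [/key h1 /key h2] := H1 (a + s) y (le_trans (nx _ asI) sd1) (le_trans ys sd1).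
  have [/key h3 /key h4] := H1 a y (le_trans (nx _ aI) sd1) (le_trans ys sd1).
  have := normr4_le (h1 _ (nx _ asI)) (h2 _ ys) (h3 _ (nx _ aI)) (h4 _ ys).
  rewrite Pe [P a y]Pe; congr (_ <= _); congr `|_|; ring.
have EQ : `|\int[lam]_(x in `[a, a + s[) (Q x (c + s) - Q x c) - qy * s * s|
    <= 4 * (e / 9 * s) * s.
  have := @Rintegral_near_cst _ _ lam `[a, a + s[%classic
    (fun x => Q x (c + s) - Q x c) (qy * s) (4 * (e / 9 * s)).
  rewrite lam_itvco// (_ : a + s - a = s); last ring.
  apply=> //.
  - exact: lam_itvco_fin.
  - by apply: integrable_itvco; apply: contB; exact: cQ.
  move=> x /=; rewrite in_itv/= => /andP[y1 y2].
  have /nx xs : a <= x <= a + s by rewrite y1 ltW.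
  have [/key h1 /key h2] := H2 x (c + s) (le_trans xs sd2) (le_trans (ny _ csI) sd2).
  have [/key h3 /key h4] := H2 x c (le_trans xs sd2) (le_trans (ny _ cI) sd2).
  have := normr4_le (h1 _ xs) (h2 _ (ny _ csI)) (h3 _ xs) (h4 _ (ny _ cI)).
  rewrite Qe [Q x c]Qe; congr (_ <= _); congr `|_|; ring.
have ED : `|\int[pm]_(z in rect a (a + s) c (c + s)) D z - D (x0, y0) * (s * s)|
    <= e / 9 * (s * s).
  have E : pm (rect a (a + s) c (c + s)) = (s * s)%:E.
    by rewrite pm_rect//; congr (_ * _)%:E; ring.
  rewrite (_ : s * s = fine (pm (rect a (a + s) c (c + s)))); last by rewrite E.
  apply: Rintegral_near_cst.
  - exact: measurable_rect.
  - by rewrite [X in (X < _)%E]E ltry.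
  - exact: iDs.
  move=> [x y]; rewrite /rect/= => -[]; rewrite !in_itv/= => /andP[x1 x2] /andP[y1 y2].
  by apply: H3; [apply: le_trans (nx _ _) sd3|apply: le_trans (ny _ _) sd3]; rewrite ?x1 ?y1/= ltW.
by move: ED; rewrite -pqD => ED; exact: (flux_error EP EQ ED).
Qed.

Lemma phi_quarter a c s : 0 <= s -> l <= a -> a + s <= l + h -> l <= c -> c + s <= l + h ->
  let t := s / 2 in
  phi a c s = phi a c t + phi a (c + t) t + (phi (a + t) c t + phi (a + t) (c + t) t).
Proof.
move=> s0 la ah lc ch t.
have t0 : 0 <= t by rewrite divr_ge0.
have st : s = t + t by rewrite -splitr.
rewrite /phi st !addrA.
have i1 := iDs s0 la ah lc ch.
rewrite (@flux_split_x P Q D cP cQ a (a + t)); [|lra..|by rewrite -!addrA -st].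
rewrite (@flux_split_y P Q D cP cQ a _ c (c + t)); [|lra..|]; last first.
  apply: integrableS i1; try exact: measurable_rect.
  move=> [x y]; rewrite /rect/= => -[]; rewrite !in_itv/= => /andP[h1 h2] /andP[h3 h4].
  by split; apply/andP; split; lra.
rewrite (@flux_split_y P Q D cP cQ (a + t) _ c (c + t)); [|lra..|]; last first.
  apply: integrableS i1; try exact: measurable_rect.
  move=> [x y]; rewrite /rect/= => -[]; rewrite !in_itv/= => /andP[h1 h2] /andP[h3 h4].
  by split; apply/andP; split; lra.
by rewrite !addrA.
Qed.

(* Bisection: a square carrying flux at least [E] times its area has a quarter
   with the same property, and nested quarters shrink to a point where
   [flux_local] fails. *)
Lemma goursat : phi l l h = 0.
Proof.
apply/eqP; rewrite -normr_eq0; apply/negPn/negP => phi0.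
have {}phi0 : 0 < `|phi l l h| by rewrite lt_neqAle eq_sym phi0 normr_ge0.
pose E := `|phi l l h| / h ^+ 2.
have E0 : 0 < E by rewrite divr_gt0// exprn_gt0.
pose s N := h / 2 ^+ N.
have s0 N : 0 < s N by rewrite divr_gt0// exprn_gt0.
have sS N : s N.+1 = s N / 2 by rewrite /s exprS invfM mulrA mulrAC.
pose Good N (p : R * R) := [/\ l <= p.1, p.1 + s N <= l + h, l <= p.2,
  p.2 + s N <= l + h & E * s N ^+ 2 <= `|phi p.1 p.2 (s N)|].
pose Rel N (p q : R * R) := [/\ p.1 <= q.1, q.1 + s N.+1 <= p.1 + s N,
  p.2 <= q.2 & q.2 + s N.+1 <= p.2 + s N].
(* The implication makes the statement total, as [choice] requires; a corner that is not [Good] is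
   sent to the arbitrary value [(0, 0)]. *)
have step (Np : nat * (R * R)) : exists q, Good Np.1 Np.2 -> Good Np.1.+1 q /\ Rel Np.1 Np.2 q.
  move: Np => [N [a c]] /=.
  have [[/= la ah lc ch Ep]|nG] := pselect (Good N (a, c)); last by exists (0, 0).
  have := phi_quarter (ltW (s0 N)) la ah lc ch; rewrite /= -sS => phiE.
  have sE := sS N; have sN1 := s0 N.+1.
  have sq : s N ^+ 2 = 4 * s N.+1 ^+ 2 by rewrite sE; field.
  have [|h1] := leP (E * s N.+1 ^+ 2) `|phi a c (s N.+1)|.
    by exists (a, c) => _; split; split => //=; have [[? ? ? ? ?] ?] := half_in_itv lc ch sE sN1; have [[? ? ? ? ?] ?] := half_in_itv la ah sE sN1.
  have [|h2] := leP (E * s N.+1 ^+ 2) `|phi a (c + s N.+1) (s N.+1)|.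
    by exists (a, c + s N.+1) => _; split; split => //=; have [[? ? ? ? ?] ?] := half_in_itv lc ch sE sN1; have [[? ? ? ? ?] ?] := half_in_itv la ah sE sN1.
  have [|h3] := leP (E * s N.+1 ^+ 2) `|phi (a + s N.+1) c (s N.+1)|.
    by exists (a + s N.+1, c) => _; split; split => //=; have [[? ? ? ? ?] ?] := half_in_itv lc ch sE sN1; have [[? ? ? ? ?] ?] := half_in_itv la ah sE sN1.
  have [|h4] := leP (E * s N.+1 ^+ 2) `|phi (a + s N.+1) (c + s N.+1) (s N.+1)|.
    by exists (a + s N.+1, c + s N.+1) => _; split; split => //=; have [[? ? ? ? ?] ?] := half_in_itv lc ch sE sN1; have [[? ? ? ? ?] ?] := half_in_itv la ah sE sN1.
  (* If all four quarters fell below [E] times their area, so would the whole square. *)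
  move: Ep; rewrite phiE sq => Ep; exfalso.
  have := le_trans Ep (ler_normD _ _).
  have := ler_normD (phi a c (s N.+1)) (phi a (c + s N.+1) (s N.+1)).
  have := ler_normD (phi (a + s N.+1) c (s N.+1)) (phi (a + s N.+1) (c + s N.+1) (s N.+1)).
  exact: sum4_lt.
have [F HF] := choice step.
pose p := fix p N := if N is M.+1 then F (M, p M) else (l, l).
have pG N : Good N (p N).
  elim: N => [|N /(HF (N, p N))[]//].
  by split; rewrite /= ?lexx// /s expr0 divr1// /E divfK// gt_eqF// exprn_gt0.
have pR N : Rel N (p N) (p N.+1) by have [] := HF (N, p N) (pG N).
(* Nested intervals: the supremum of the left endpoints lies in all of them. *)
have mono (u : nat -> R) : (forall N, u N <= u N.+1 /\ u N.+1 + s N.+1 <= u N + s N) ->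
  exists x, forall N, u N <= x <= u N + s N.
  move=> uS.
  have ui M N : (M <= N)%N -> u M <= u N.
    by move=> /subnK <-; elim: (N - M)%N => //= k; move/le_trans; apply; have [] := uS (k + M)%N.
  have ud M N : (M <= N)%N -> u N + s N <= u M + s M.
    move=> /subnK <-; elim: (N - M)%N => //= k; apply: le_trans; exact: (uS (k + M)%N).2.
  have ub N M : u M <= u N + s N.
    have [MN|NM] := leqP M N; first by rewrite (le_trans (ui _ _ MN))// lerDl ltW.
    by rewrite (le_trans _ (ud _ _ (ltnW NM)))// lerDl ltW.
  exists (sup (range u)) => N; apply/andP; split.
    apply: ub_le_sup; last by exists N.
    by exists (u 0%N + s 0%N) => _ [M _ <-].
  by apply: ge_sup; [exists (u 0%N), 0%N|move=> _ [M _ <-]].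
have [x0 Hx] : exists x, forall N, (p N).1 <= x <= (p N).1 + s N.
  by apply: mono => N; have [] := pR N.
have [y0 Hy] : exists x, forall N, (p N).2 <= x <= (p N).2 + s N.
  by apply: mono => N; have [] := pR N.
have E2 : 0 < E / 2 by rewrite divr_gt0.
have [d d0 Hd] := flux_local x0 y0 E2.
pose N := Num.bound (h / d).
have sNd : s N <= d.
  rewrite /s ler_pdivrMr ?exprn_gt0// mulrC -ler_pdivrMr//.
  have /ltW/le_trans := archi_boundP (ltW (divr_gt0 h0 d0)); apply.
  by rewrite -natrX ler_nat ltnW// ltn_expl.
have [h1 h2 h3 h4 h5] := pG N.
have := Hd (p N).1 (p N).2 (s N) (ltW (s0 N)) sNd (Hx N) (Hy N) h1 h2 h3 h4.
have : 0 < E / 2 * s N ^+ 2 by rewrite mulr_gt0// exprn_gt0.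
move: h5; lra.
Qed.

End goursat.
End Goursat.

(** * Weighted integrals over the disc *)

Section BergmanL2.
Context {R : realType}.
Local Notation C := R[i].
Local Notation pm := (@plane_measure R).
Local Notation T2 := (measurableTypeR R * measurableTypeR R)%type.
Local Notation mfun := (@measurable_fun _ _ T2 R plane_disc).
Local Notation D := (@plane_disc R).
Local Notation Re := (@complex.Re R).
Local Notation Im := (@complex.Im R).
Local Notation "x %:C" := (real_complex R x).

Definition sqn (z : C) : R := Re z ^+ 2 + Im z ^+ 2.

Lemma cReD (z w : C) : Re (z + w) = Re z + Re w. Proof. by case: z w => [? ?] []. Qed.
Lemma cImD (z w : C) : Im (z + w) = Im z + Im w. Proof. by case: z w => [? ?] []. Qed.
Lemma cReM (z w : C) : Re (z * w) = Re z * Re w - Im z * Im w.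
Proof. by case: z w => [? ?] []. Qed.
Lemma cImM (z w : C) : Im (z * w) = Re z * Im w + Im z * Re w.
Proof. by case: z w => [? ?] []. Qed.
Lemma cReN (z : C) : Re (- z) = - Re z. Proof. by case: z. Qed.
Lemma cImN (z : C) : Im (- z) = - Im z. Proof. by case: z. Qed.
Lemma cReJ (z : C) : Re (conjc z) = Re z. Proof. by case: z. Qed.
Lemma cImJ (z : C) : Im (conjc z) = - Im z. Proof. by case: z. Qed.
Definition ReImE := (cReM, cImM, cReD, cImD, cReN, cImN, cReJ, cImJ).

Lemma sqn_ge0 z : 0 <= sqn z.
Proof. by rewrite addr_ge0// sqr_ge0. Qed.

Lemma sqnM z w : sqn (z * w) = sqn z * sqn w.
Proof. by rewrite /sqn !ReImE; ring. Qed.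

Lemma norm_sqn z : `|z| = (Num.sqrt (sqn z))%:C.
Proof. exact: normc_def. Qed.

Lemma Re_norm_sqr z : Re `|z| ^+ 2 = sqn z.
Proof. by rewrite norm_sqn/= sqr_sqrtr// sqn_ge0. Qed.

Lemma mul_conjc z : z * conjc z = (sqn z)%:C.
Proof. by case: z => x y; apply/eqP; rewrite eq_complex/= /sqn/=; apply/andP; split; apply/eqP; ring. Qed.

Lemma sqn_eq0 z : sqn z = 0 -> z = 0.
Proof.
case: z => x y; rewrite /sqn/= => /eqP; rewrite paddr_eq0 ?sqr_ge0// !sqrf_eq0.
by move=> /andP[/eqP-> /eqP->].
Qed.

Lemma norm_lt_sqn z (r : R) : 0 < r -> (`|z| < r%:C) = (sqn z < r ^+ 2).
Proof.
move=> r0; rewrite norm_sqn ltcR -{1}(ger0_norm (ltW r0)) -sqrtr_sqr.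
by rewrite ltr_sqrt// exprn_gt0.
Qed.

Lemma norm_lt1 z : (`|z| < 1 :> C) = (sqn z < 1).
Proof. by rewrite (_ : 1 = 1%:C)// norm_lt_sqn// expr1n. Qed.

Lemma unit_discE z : unit_disc z = (sqn z < 1) :> Prop.
Proof. by rewrite /unit_disc/= norm_lt1. Qed.

Definition plane_sqn (p : R * R) : R := p.1 ^+ 2 + p.2 ^+ 2.

Lemma sqn_plane p : sqn (of_plane p) = plane_sqn p. Proof. by []. Qed.

Lemma plane_discE : D = [set p | plane_sqn p < 1].
Proof. by apply/seteqP; split=> p; rewrite /plane_disc/= unit_discE. Qed.

Lemma plane_discP p : D p <-> plane_sqn p < 1.
Proof. by rewrite plane_discE. Qed.

Lemma measurable_u2 : @measurable_fun _ _ T2 R setT plane_sqn.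
Proof.
by apply: measurable_funD; apply: measurable_funX;
  [exact: measurable_fst|exact: measurable_snd].
Qed.

Lemma measurable_disc : measurable (D : set T2).
Proof.
rewrite plane_discE (_ : [set p | _] = setT `&` plane_sqn @^-1` `]-oo, 1[%classic).
  by apply: measurable_u2.
by rewrite setTI; apply/seteqP; split=> p /=; rewrite in_itv.
Qed.
Hint Resolve measurable_disc : core.

Section weight.
Variable alpha : R.
Hypothesis alpha_gt : -1 < alpha.
Implicit Types (h g : R * R -> R) (F G : C -> C).

Definition dens (p : R * R) : R := dA_density alpha (of_plane p).

Lemma densE p : dens p = (1 + alpha) * (1 - plane_sqn p) `^ alpha / pi.
Proof. by rewrite /dens /dA_density Re_norm_sqr. Qed.

Lemma measurable_dens : @measurable_fun _ _ T2 R setT dens.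
Proof.
rewrite (_ : dens = fun p => (1 + alpha) * (1 - plane_sqn p) `^ alpha / pi); last first.
  by apply/funext => p; rewrite densE.
apply: measurable_funM => //; apply: measurable_funM => //.
apply: (measurableT_comp (measurable_powR _)).
by apply: measurable_funB => //; exact: measurable_u2.
Qed.

Lemma dens_ge0 p : 0 <= dens p.
Proof.
have a0 : 0 <= 1 + alpha by rewrite -lerBlDl sub0r ltW.
by rewrite densE mulr_ge0 ?invr_ge0 ?pi_ge0// mulr_ge0// powR_ge0.
Qed.

Lemma dens_gt0 p : D p -> 0 < dens p.
Proof.
move=> /plane_discP Dp.
have a0 : 0 < 1 + alpha by rewrite -ltrBlDl sub0r.
by rewrite densE mulr_gt0 ?invr_gt0 ?pi_gt0// mulr_gt0// powR_gt0// subr_gt0.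
Qed.

Definition dens_integrable (h : R * R -> R) := pm.-integrable D (EFin \o (fun p => h p * dens p)).

Lemma measurable_densD : mfun dens.
Proof. exact: measurable_funS measurable_dens. Qed.

Lemma dens_integrable_le h g : mfun h -> dens_integrable g ->
  (forall p, D p -> `|h p| <= `|g p|) -> dens_integrable h.
Proof.
move=> mh ig hg; apply: le_integrable ig => //.
  by apply/measurable_EFinP; apply: measurable_funM => //; exact: measurable_densD.
move=> p Dp; rewrite /= lee_fin !normrM ler_pM//; exact: hg.
Qed.

Lemma dens_integrableD h g : dens_integrable h -> dens_integrable g -> dens_integrable (fun p => h p + g p).
Proof.
move=> ih ig; rewrite /dens_integrable (_ : EFin \o _ =
  (fun p => (h p * dens p)%:E + (g p * dens p)%:E)%E).
  exact: (integrableD measurable_disc ih ig).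
by apply/funext => p /=; rewrite mulrDl EFinD.
Qed.

Lemma dens_integrableZ k h : dens_integrable h -> dens_integrable (fun p => k * h p).
Proof.
move=> ih; rewrite /dens_integrable (_ : EFin \o _ =
  (fun p => k%:E * (h p * dens p)%:E)%E).
  exact: (integrableZl measurable_disc _ ih).
by apply/funext => p /=; rewrite -mulrA EFinM.
Qed.

Lemma dens_integrableN h : dens_integrable h -> dens_integrable (fun p => - h p).
Proof.
by move=> /(dens_integrableZ (-1)); congr dens_integrable; apply/funext => p; rewrite mulN1r.
Qed.

Lemma dens_integrableB h g : dens_integrable h -> dens_integrable g -> dens_integrable (fun p => h p - g p).
Proof. by move=> ih ig; apply: dens_integrableD => //; exact: dens_integrableN. Qed.

(** The bound [|h g| <= h^2 + g^2] suffices, since only integrability of the product is wanted. *)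
Lemma dens_integrable_prod h g : mfun h -> mfun g ->
  dens_integrable (fun p => h p ^+ 2) -> dens_integrable (fun p => g p ^+ 2) -> dens_integrable (fun p => h p * g p).
Proof.
move=> mh mg ih ig; apply: dens_integrable_le (dens_integrableD ih ig) _; first exact: measurable_funM.
move=> p _; rewrite [X in _ <= X]ger0_norm ?addr_ge0 ?sqr_ge0//.
rewrite -(@real_normK _ (h p)) ?num_real// -(@real_normK _ (g p)) ?num_real// normrM.
have := sqr_ge0 (`|h p| - `|g p|); have := sqr_ge0 (`|h p| + `|g p|).
nra.
Qed.

Definition cmeasurable (F : C -> C) :=
  mfun (fun p => Re (F (of_plane p))) /\
  mfun (fun p => Im (F (of_plane p))).

Definition cintegrable (F : C -> C) :=
  [/\ cmeasurable F, dens_integrable (fun p => Re (F (of_plane p))) & dens_integrable (fun p => Im (F (of_plane p)))].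

Lemma eq_measD (f g : R * R -> R) : f = g -> mfun f -> mfun g.
Proof. by move->. Qed.

Lemma cmeasD F G : cmeasurable F -> cmeasurable G -> cmeasurable (fun z => F z + G z).
Proof.
move=> [f1 f2] [g1 g2]; split.
  by apply: eq_measD (measurable_funD f1 g1); apply/funext => p /=; rewrite cReD.
by apply: eq_measD (measurable_funD f2 g2); apply/funext => p /=; rewrite cImD.
Qed.

Lemma cmeasM F G : cmeasurable F -> cmeasurable G -> cmeasurable (fun z => F z * G z).
Proof.
move=> [f1 f2] [g1 g2]; split.
  apply: eq_measD (measurable_funB (measurable_funM f1 g1) (measurable_funM f2 g2)).
  by apply/funext => p /=; rewrite cReM.
apply: eq_measD (measurable_funD (measurable_funM f1 g2) (measurable_funM f2 g1)).
by apply/funext => p /=; rewrite cImM.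
Qed.

Lemma cmeasJ F : cmeasurable F -> cmeasurable (fun z => conjc (F z)).
Proof.
move=> [f1 f2]; split; first by apply: eq_measD f1; apply/funext => p /=; rewrite cReJ.
by apply: eq_measD (measurable_funN f2); apply/funext => p /=; rewrite cImJ.
Qed.

Lemma cmeas_cst c : cmeasurable (fun=> c).
Proof. by split; exact: measurable_cst. Qed.

Lemma cmeas_id : cmeasurable id.
Proof.
by split; apply: (@measurable_funS _ _ _ _ setT) => //;
  [exact: measurable_fst|exact: measurable_snd].
Qed.

Lemma cmeasX F m : cmeasurable F -> cmeasurable (fun z => F z ^+ m).
Proof.
move=> mF; elim: m => [|m IH]; first exact: cmeas_cst.
by rewrite (_ : (fun z => _) = fun z => F z * F z ^+ m); [exact: cmeasM|apply/funext => z; rewrite exprS].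
Qed.

Lemma cmeas_real (h : R * R -> R) F : mfun h ->
  (forall p, F (of_plane p) = (h p)%:C) -> cmeasurable F.
Proof.
move=> mh Fh; split; first by apply: eq_measD mh; apply/funext => p; rewrite Fh.
by apply: eq_measD (@measurable_cst _ _ _ _ _ (0:R)); apply/funext => p; rewrite Fh.
Qed.

Lemma cintD F G : cintegrable F -> cintegrable G -> cintegrable (fun z => F z + G z).
Proof.
move=> [mF f1 f2] [mG g1 g2]; split; first exact: cmeasD.
  by move: (dens_integrableD f1 g1); congr dens_integrable; apply/funext => p; rewrite cReD.
by move: (dens_integrableD f2 g2); congr dens_integrable; apply/funext => p; rewrite cImD.
Qed.

Lemma cintZ c F : cintegrable F -> cintegrable (fun z => c * F z).
Proof.
move=> [mF f1 f2]; split; first by apply: cmeasM => //; exact: cmeas_cst.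
  by move: (dens_integrableB (dens_integrableZ (Re c) f1) (dens_integrableZ (Im c) f2)); congr dens_integrable; apply/funext => p; rewrite cReM.
by move: (dens_integrableD (dens_integrableZ (Re c) f2) (dens_integrableZ (Im c) f1)); congr dens_integrable; apply/funext => p; rewrite cImM.
Qed.

Lemma cintM_bounded F G M : cintegrable F -> cmeasurable G -> 
  (forall z, unit_disc z -> `|Re (G z)| <= M /\ `|Im (G z)| <= M) ->
  cintegrable (fun z => F z * G z).
Proof.
move=> [mF f1 f2] mG GM.
have bd (h g : R * R -> R) : mfun h -> mfun g -> dens_integrable h -> (forall p, D p -> `|g p| <= M) ->
    dens_integrable (fun p => h p * g p).
  move=> mh mg ih gM; apply: dens_integrable_le (dens_integrableZ M ih) _; first exact: measurable_funM.
  move=> p Dp; rewrite !normrM mulrC ler_wpM2r//.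
  by rewrite (le_trans (gM _ Dp))// ler_norm.
have G1 p : D p -> `|Re (G (of_plane p))| <= M by move=> /GM[].
have G2 p : D p -> `|Im (G (of_plane p))| <= M by move=> /GM[].
have [m1 m2] := mF; have [m3 m4] := mG.
split; first exact: cmeasM.
  have := dens_integrableB (bd _ _ m1 m3 f1 G1) (bd _ _ m2 m4 f2 G2).
  by congr dens_integrable; apply/funext => p; rewrite cReM.
have := dens_integrableD (bd _ _ m1 m4 f1 G2) (bd _ _ m2 m3 f2 G1).
by congr dens_integrable; apply/funext => p; rewrite cImM.
Qed.

Local Notation dI := (disc_integral alpha).

Lemma disc_integralE F : dI F = Complex (\int[pm]_(p in D) (Re (F (of_plane p)) * dens p))
  (\int[pm]_(p in D) (Im (F (of_plane p)) * dens p)).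
Proof. by []. Qed.

Lemma eq_disc_integral F G : (forall z, unit_disc z -> F z = G z) -> dI F = dI G.
Proof.
move=> FG; rewrite !disc_integralE; congr Complex; apply: eq_Rintegral => p;
  by rewrite inE => Dp; rewrite FG.
Qed.

Lemma disc_integralD F G : cintegrable F -> cintegrable G -> dI (fun z => F z + G z) = dI F + dI G.
Proof.
move=> [_ f1 f2] [_ g1 g2]; rewrite !disc_integralE; apply/eqP; rewrite eq_complex/=.
apply/andP; split; apply/eqP.
  by rewrite -RintegralD//; apply: eq_Rintegral => p _; rewrite cReD mulrDl.
by rewrite -RintegralD//; apply: eq_Rintegral => p _; rewrite cImD mulrDl.
Qed.

Lemma disc_integralZ c F : cintegrable F -> dI (fun z => c * F z) = c * dI F.
Proof.
case: c => a b [_ f1 f2]; rewrite !disc_integralE; apply/eqP; rewrite eq_complex/=.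
have i1 k := dens_integrableZ k f1; have i2 k := dens_integrableZ k f2.
have E k (h : R * R -> R) : dens_integrable h -> k * (\int[pm]_(p in D) (h p * dens p)) =
    \int[pm]_(p in D) (k * h p * dens p).
  by move=> ih; rewrite -RintegralZl//; apply: eq_Rintegral => p _; rewrite mulrA.
apply/andP; split; apply/eqP; rewrite !E//.
  by rewrite -RintegralB//; [apply: eq_Rintegral => p _; rewrite cReM/= mulrBl|exact: i1|exact: i2].
by rewrite -RintegralD//; [apply: eq_Rintegral => p _; rewrite cImM/= mulrDl|exact: i2|exact: i1].
Qed.

Lemma disc_integralJ F : cintegrable F -> dI (fun z => conjc (F z)) = conjc (dI F).
Proof.
move=> [_ f1 f2]; rewrite !disc_integralE; apply/eqP; rewrite eq_complex/=.
apply/andP; split; apply/eqP; first by apply: eq_Rintegral => p _; rewrite cReJ.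
rewrite -mulN1r -RintegralZl//; apply: eq_Rintegral => p _; rewrite cImJ; ring.
Qed.

Lemma L2P f : L2 alpha f <-> cmeasurable f /\ dens_integrable (fun p => sqn (f (of_plane p))).
Proof.
have ge p : (0 <= (sqn (f (of_plane p)) * dens p)%:E)%E.
  by rewrite lee_fin mulr_ge0 ?sqn_ge0 ?dens_ge0.
have mf : cmeasurable f -> @measurable_fun _ _ T2 _ D (EFin \o (fun p => sqn (f (of_plane p)) * dens p)).
  move=> [m1 m2]; apply/measurable_EFinP; apply: measurable_funM; last exact: measurable_densD.
  by apply: measurable_funD; exact: measurable_funX.
split=> [[m1 m2 fi]|[[m1 m2] fi]].
  split; first by split.
  apply/integrableP; split; first exact: mf.
  apply: le_lt_trans fi; rewrite le_eqVlt; apply/orP; left; apply/eqP.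
  by apply: eq_integral => p _; rewrite gee0_abs//= Re_norm_sqr.
split => //; move/integrableP: fi => [_]; apply: le_lt_trans.
rewrite le_eqVlt; apply/orP; left; apply/eqP.
by apply: eq_integral => p _; rewrite gee0_abs//= Re_norm_sqr.
Qed.

Lemma rint_sqr_of_sqn f : L2 alpha f ->
  dens_integrable (fun p => Re (f (of_plane p)) ^+ 2) /\ dens_integrable (fun p => Im (f (of_plane p)) ^+ 2).
Proof.
move=> /L2P[[m1 m2] fi]; split; apply: dens_integrable_le fi _; try exact: measurable_funX.
  by move=> p _; rewrite !ger0_norm ?sqn_ge0 ?sqr_ge0// lerDl sqr_ge0.
by move=> p _; rewrite !ger0_norm ?sqn_ge0 ?sqr_ge0// lerDr sqr_ge0.
Qed.

Lemma L2_cint (f g : C -> C) : L2 alpha f -> L2 alpha g -> cintegrable (fun z => f z * conjc (g z)).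
Proof.
move=> Lf Lg; have [/[dup] mf [m1 m2] _] := iffLR (L2P _) Lf.
have [/[dup] mg [m3 m4] _] := iffLR (L2P _) Lg.
have [r1 r2] := rint_sqr_of_sqn Lf; have [r3 r4] := rint_sqr_of_sqn Lg.
split; first by apply: cmeasM => //; exact: cmeasJ.
  have := dens_integrableD (dens_integrable_prod m1 m3 r1 r3) (dens_integrable_prod m2 m4 r2 r4).
  by congr dens_integrable; apply/funext => p; rewrite !ReImE; ring.
have := dens_integrableB (dens_integrable_prod m2 m3 r2 r3) (dens_integrable_prod m1 m4 r1 r4).
by congr dens_integrable; apply/funext => p; rewrite !ReImE; ring.
Qed.

Lemma L2_of_rint f : cmeasurable f -> dens_integrable (fun p => sqn (f (of_plane p))) -> L2 alpha f.
Proof. by move=> *; apply/L2P. Qed.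

Lemma L2_le (f g : C -> C) : cmeasurable f -> L2 alpha g ->
  (forall z, unit_disc z -> sqn (f z) <= sqn (g z)) -> L2 alpha f.
Proof.
move=> mf /L2P[_ ig] fg; apply: L2_of_rint => //; apply: dens_integrable_le ig _.
  by case: mf => m1 m2; apply: measurable_funD; exact: measurable_funX.
by move=> p Dp; rewrite !ger0_norm ?sqn_ge0//; exact: fg.
Qed.

Lemma L2D (f g : C -> C) : L2 alpha f -> L2 alpha g -> L2 alpha (fun z => f z + g z).
Proof.
move=> /L2P[mf fi] /L2P[mg gi].
have mfg := cmeasD mf mg.
apply: L2_of_rint => //; apply: dens_integrable_le (dens_integrableZ 2 (dens_integrableD fi gi)) _.
  by case: mfg => m1 m2; apply: measurable_funD; exact: measurable_funX.
move=> p _; have := sqn_ge0 (f (of_plane p)); have := sqn_ge0 (g (of_plane p)).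
move=> g0 f0; rewrite !ger0_norm ?sqn_ge0//; last by rewrite mulr_ge0// addr_ge0.
rewrite /sqn !ReImE.
have := sqr_ge0 (Re (f (of_plane p)) - Re (g (of_plane p))).
have := sqr_ge0 (Im (f (of_plane p)) - Im (g (of_plane p))).
by rewrite !expr2; lra.
Qed.

Lemma L2M_bounded (f h : C -> C) : L2 alpha f -> cmeasurable h -> (forall z, unit_disc z -> sqn (h z) <= 1) ->
  L2 alpha (fun z => h z * f z).
Proof.
move=> Lf mh h1; have [mf _] := iffLR (L2P _) Lf.
apply: L2_le Lf _; first exact: cmeasM.
by move=> z Dz; rewrite sqnM ler_piMl ?sqn_ge0// h1.
Qed.

Lemma L2Z c f : L2 alpha f -> L2 alpha (fun z => c * f z).
Proof.
move=> /L2P[mf fi]; apply: L2_of_rint; first by apply: cmeasM => //; exact: cmeas_cst.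
by move: (dens_integrableZ (sqn c) fi); congr dens_integrable; apply/funext => p; rewrite sqnM.
Qed.

Lemma L2_0 : L2 alpha (fun=> 0).
Proof.
apply: L2_of_rint; first exact: cmeas_cst.
rewrite /dens_integrable (_ : EFin \o _ = fun=> 0%E); first exact: integrable0.
by apply/funext => p; rewrite /sqn/= !expr0n addr0 mul0r.
Qed.

Lemma innerDl (f g h : C -> C) : L2 alpha f -> L2 alpha g -> L2 alpha h ->
  inner alpha (fun z => f z + g z) h = inner alpha f h + inner alpha g h.
Proof.
move=> Lf Lg Lh; rewrite /inner -disc_integralD; try exact: L2_cint.
by congr disc_integral; apply/funext => z; rewrite mulrDl.
Qed.

Lemma innerZl c (f h : C -> C) : L2 alpha f -> L2 alpha h ->
  inner alpha (fun z => c * f z) h = c * inner alpha f h.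
Proof.
move=> Lf Lh; rewrite /inner -disc_integralZ; last exact: L2_cint.
by congr disc_integral; apply/funext => z; rewrite mulrA.
Qed.

End weight.
End BergmanL2.
#[global] Hint Resolve measurable_disc : core.

(** * Wirtinger derivatives *)

Section Dbar.
Context {R : realType}.
Local Notation C := R[i].
Local Notation pm := (@plane_measure R).
Local Notation Re := (@complex.Re R).
Local Notation Im := (@complex.Im R).
Local Notation "x %:C" := (real_complex R x).
Implicit Types (F G : C -> C).

(* A one-constructor type rather than a definition, to keep unification from
   unfolding the topology of [C]. *)
Variant ctn_at F (z0 : C) : Prop := Ct of {for (z0 : C^o), continuous (F : C^o -> C^o)}.

Lemma pos_complex (e : C) : 0 < e -> exists2 r : R, 0 < r & e = r%:C.
Proof.
case: e => a b; rewrite ltcE/= => /andP[/eqP b0 a0].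
by exists a => //; rewrite b0.
Qed.

(** Continuity in real coordinates, with the quantifiers of [slopes]. The norm of [R[i]] takes
    values in [R[i]], so the radii given by filters are complex numbers that first have to be
    recognized as real. *)
Definition box_ctn_at F z0 := forall e, 0 < e -> exists2 d, 0 < d & forall z,
  `|Re z - Re z0| <= d -> `|Im z - Im z0| <= d ->
  `|Re (F z) - Re (F z0)| <= e /\ `|Im (F z) - Im (F z0)| <= e.

Lemma cReB (z w : C) : Re (z - w) = Re z - Re w. Proof. by rewrite cReD cReN. Qed.
Lemma cImB (z w : C) : Im (z - w) = Im z - Im w. Proof. by rewrite cImD cImN. Qed.

Lemma sqr_le_sqn (x y e : R) : 0 <= e -> x ^+ 2 + y ^+ 2 <= e ^+ 2 -> `|x| <= e.
Proof.
move=> e0 h; have : x ^+ 2 <= e ^+ 2 by apply: le_trans h; rewrite lerDl sqr_ge0.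
by rewrite -[x ^+ 2]real_normK ?num_real// ler_sqr// nnegrE.
Qed.

Lemma sqr_norm_le (x e : R) : `|x| <= e -> x ^+ 2 <= e ^+ 2.
Proof.
move=> xe; rewrite -[x ^+ 2]real_normK ?num_real// ler_sqr// nnegrE.
exact: le_trans xe.
Qed.

Lemma near_boxP (P : C -> Prop) (z0 : C) : 
  (\forall z \near (z0 : C^o), P z) <-> (exists2 d : R, 0 < d & forall z,
  `|Re z - Re z0| <= d -> `|Im z - Im z0| <= d -> P z).
Proof.
split=> [/nbhs_ballP[e /= /pos_complex[r r0 ->] H]|[d d0 H]].
  (* A box of half-side [r / 2] lies in the ball of radius [r], because [2 (r / 2)^2 < r^2]. *)
  exists (r / 2); first by rewrite divr_gt0.
  move=> z hx hy; apply: H; rewrite /ball/= norm_lt_sqn// /sqn cReB cImB.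
  have : (Re z0 - Re z) ^+ 2 <= (r / 2) ^+ 2 by apply: sqr_norm_le; rewrite distrC.
  have : (Im z0 - Im z) ^+ 2 <= (r / 2) ^+ 2 by apply: sqr_norm_le; rewrite distrC.
  have : 0 < r ^+ 2 by rewrite exprn_gt0.
  by rewrite exprMn; lra.
apply/nbhs_ballP; exists d%:C; first by rewrite /= ltcR.
move=> z; rewrite /ball/= norm_lt_sqn// => /ltW; rewrite /sqn cReB cImB => h.
apply: H; rewrite distrC; first exact: sqr_le_sqn (ltW d0) h.
by apply: sqr_le_sqn (ltW d0) _; rewrite addrC; exact: h.
Qed.

Lemma ct_box F z0 : ctn_at F z0 <-> box_ctn_at F z0.
Proof.
split=> [[cF] e e0|h].
  have /cvgrPdist_lt h : (F : C^o -> C^o) z @[z --> (z0 : C^o)] --> (F z0 : C^o) := cF.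
  have /h/near_boxP[d d0 H] : 0 < e%:C by rewrite ltcR.
  exists d => // z zx zy; have := H z zx zy.
  rewrite norm_lt_sqn// => /ltW; rewrite /sqn cReB cImB => H1.
  split; rewrite distrC; first exact: sqr_le_sqn (ltW e0) H1.
  by apply: sqr_le_sqn (ltW e0) _; rewrite addrC; exact: H1.
apply: Ct; suff cF : (F : C^o -> C^o) z @[z --> (z0 : C^o)] --> (F z0 : C^o) by exact: cF.
apply/(@cvgrPdist_lt _ C^o _ _ (nbhs_filter (z0 : C^o))) => e /pos_complex[r r0 ->]; apply/near_boxP.
have r2 : 0 < r / 2 by rewrite divr_gt0.
have [d d0 H] := h _ r2; exists d => // z zx zy; have [H1 H2] := H z zx zy.
rewrite norm_lt_sqn// /sqn cReB cImB.
have : (Re (F z0) - Re (F z)) ^+ 2 <= (r / 2) ^+ 2 by apply: sqr_norm_le; rewrite distrC.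
have : (Im (F z0) - Im (F z)) ^+ 2 <= (r / 2) ^+ 2 by apply: sqr_norm_le; rewrite distrC.
have : 0 < r ^+ 2 by rewrite exprn_gt0.
by rewrite exprMn; lra.
Qed.

Lemma ctD F G z0 : ctn_at F z0 -> ctn_at G z0 -> ctn_at (fun z => F z + G z) z0.
Proof. by move=> [f] [g]; apply: Ct; exact: (@cvgD _ C^o _ _ (nbhs_filter (z0 : C^o)) (F : C^o -> C^o) (G : C^o -> C^o) _ _ f g). Qed.

Lemma ctM F G z0 : ctn_at F z0 -> ctn_at G z0 -> ctn_at (fun z => F z * G z) z0.
Proof. by move=> [f] [g]; apply: Ct; exact: (@cvgM _ _ _ (nbhs_filter (z0 : C^o)) (F : C^o -> C^o) (G : C^o -> C^o) _ _ f g). Qed.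

Lemma ct_cst c z0 : ctn_at (fun=> c) z0. Proof. by apply: Ct; exact: (@cvg_cst C^o c C^o (nbhs (z0 : C^o)) (nbhs_filter _)). Qed.

Lemma ct_id z0 : ctn_at id z0. Proof. by apply: Ct; exact: (@cvg_id C^o (nbhs (z0 : C^o))). Qed.

Lemma ctX F m z0 : ctn_at F z0 -> ctn_at (fun z => F z ^+ m) z0.
Proof.
move=> Fc; elim: m => [|m IH]; first exact: ct_cst.
by rewrite (_ : (fun z => _) = fun z => F z * F z ^+ m); [exact: ctM|apply/funext => z; rewrite exprS].
Qed.

Lemma ctJ z0 : ctn_at (@conjc R) z0.
Proof.
apply/ct_box => e e0; exists e => // z; rewrite !cReJ !cImJ => -> h.
by split => //; rewrite -opprD normrN.
Qed.

Lemma ct_near F G z0 : (\forall z \near (z0 : C^o), F z = G z) -> ctn_at F z0 -> ctn_at G z0.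
Proof.
move=> FG [cF]; apply: Ct.
have FG0 : F z0 = G z0 := nbhs_singleton FG.
rewrite /prop_for /continuous_at -FG0; apply: cvg_trans cF; exact: (@near_eq_cvg _ _ _ (nbhs_filter (z0 : C^o))).
Qed.

Lemma ct_sqn z0 : ctn_at (fun z => (sqn z)%:C) z0.
Proof.
rewrite (_ : (fun z => _) = fun z => z * conjc z); last by apply/funext => z; rewrite mul_conjc.
by apply: ctM; [exact: ct_id|exact: ctJ].
Qed.

Lemma ct_radial (h : R -> R) z0 : {for sqn z0, continuous h} -> ctn_at (fun z => (h (sqn z))%:C) z0.
Proof.
move=> /cvgrPdist_le ch; apply/ct_box => e e0.
have /nbhs_ballP[r /= r0 H] := ch e e0.
have r2 : 0 < r / 2 by rewrite divr_gt0.
have [d d0 H'] := iffLR (ct_box _ _) (ct_sqn z0) _ r2.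
exists d => // z zx zy; have [/= zr _] := H' z zx zy.
rewrite /= subrr normr0 (ltW e0); split => //; rewrite distrC; apply: H.
rewrite /ball/= distrC (le_lt_trans zr)// ltr_pdivrMr// mulr_natr mulr2n.
by rewrite ltrDl.
Qed.

(* Caratheodory's form of [F (z0 + h) = F z0 + A h + B h^* + o(h)]: it turns the
   product rule into algebra. *)
Definition caratheodory F z0 A B := exists P1 P2 : C -> C,
  [/\ forall z, F z = F z0 + P1 z * (z - z0) + P2 z * conjc (z - z0),
     ctn_at P1 z0, ctn_at P2 z0, P1 z0 = A & P2 z0 = B].

Lemma cara_ct F z0 A B : caratheodory F z0 A B -> ctn_at F z0.
Proof.
move=> [P1 [P2 [FE c1 c2 _ _]]]; rewrite (funext FE).
have ci : ctn_at (fun z => z - z0) z0 by apply: ctD; [exact: ct_id|exact: ct_cst].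
apply: ctD; first by apply: ctD; [exact: ct_cst|exact: ctM].
apply: ctM => //.
rewrite (_ : (fun z => _) = fun z => conjc z + conjc (- z0)); last first.
  by apply/funext => z; rewrite rmorphD.
by apply: ctD; [exact: ctJ|exact: ct_cst].
Qed.

Lemma caraM F G z0 A B A' B' : caratheodory F z0 A B -> caratheodory G z0 A' B' ->
  caratheodory (fun z => F z * G z) z0 (A * G z0 + F z0 * A') (B * G z0 + F z0 * B').
Proof.
move=> cF cG; have ctG := cara_ct cG.
move: cF cG => [P1 [P2 [FE c1 c2 <- <-]]] [Q1 [Q2 [GE d1 d2 <- <-]]].
(* From [F G - F0 G0 = (F - F0) G + F0 (G - G0)]; the factor [G] stays at the variable point, so its
   continuity at [z0] is used. *)
exists (fun z => P1 z * G z + F z0 * Q1 z), (fun z => P2 z * G z + F z0 * Q2 z).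
split; [move=> z| | |by []|by []].
- by rewrite (FE z) (GE z); ring.
- by apply: ctD; apply: ctM => //; exact: ct_cst.
- by apply: ctD; apply: ctM => //; exact: ct_cst.
Qed.

(** The slope is the difference quotient, completed at [z0] by the derivative. That the conjugate
    slope can be taken zero is what complex differentiability says. *)
Lemma cara_derivable F z0 : derivable (F : C^o -> C^o) z0 1 ->
  exists A, caratheodory F z0 A 0.
Proof.
move=> dF; set A : C := 'D_1 (F : C^o -> C^o) z0.
exists A, (fun z => if z == z0 then A else (F z - F z0) / (z - z0)), (fun=> 0).
split; [move=> z| | | |by []].
- rewrite mul0r addr0; have [->|zz0] := eqVneq; first by rewrite subrr mulr0 addr0.
  by rewrite divfK ?subr_eq0// addrC subrK.
- have {}dF : h^-1 *: ((F (h *: (1 : C^o) + z0) : C^o) - F z0) @[h --> (0 : C^o)^'] --> (A : C^o).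
    exact: dF.
  apply: Ct; apply/(@cvgrPdist_lt _ C^o _ _ (nbhs_filter (z0 : C^o))) => e e0; rewrite eqxx.
  move/cvgrPdist_lt : dF => /(_ e e0); rewrite !near_withinE => /nbhs_ballP[r r0 H].
  apply/nbhs_ballP; exists r => // z zr /=.
  have [_|zz0] := eqVneq z z0; first by rewrite subrr normr0.
  have := H (z - z0); rewrite /ball/= sub0r opprB => /(_ zr).
  rewrite subr_eq0 => /(_ zz0); rewrite /GRing.scale/= mulr1 subrK.
  by rewrite mulrC.
- exact: ct_cst.
- by rewrite eqxx.
Qed.

Lemma caraX F z0 A m : caratheodory F z0 A 0 -> exists A', caratheodory (fun z => F z ^+ m) z0 A' 0.
Proof.
move=> cF; elim: m => [|m [A' IH]].
  exists 0, (fun=> 0), (fun=> 0); split => //; try exact: ct_cst.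
  by move=> z; rewrite !mul0r !addr0 !expr0.
exists (A * F z0 ^+ m + F z0 * A').
rewrite (_ : (fun z => _) = fun z => F z * F z ^+ m); last by apply/funext => z; rewrite exprS.
by have := caraM cF IH; rewrite mul0r mulr0 addr0.
Qed.

Lemma cara_inv z0 : z0 != 0 -> exists A, caratheodory (fun z => z^-1) z0 A 0.
Proof.
move=> z0n0; apply: cara_derivable.
by have := @derivableV C C^o (@id C^o) z0 1 z0n0 (@derivable_id _ _ _ _).
Qed.

(** With [u = |z|^2] and [u0 = |z0|^2], one has [u - u0 = zbar0 (z - z0) + z conj (z - z0)].
    Multiplying by the slope [q] of [L] at [u0] gives both Wirtinger slopes. *)
Lemma cara_radial (L : R -> R) z0 : derivable L (sqn z0) 1 ->
  caratheodory (fun z => (L (sqn z))%:C) z0 ((derive1 L (sqn z0))%:C * conjc z0) ((derive1 L (sqn z0))%:C * z0).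
Proof.
move=> dL; set u0 := sqn z0.
pose q u := if u == u0 then derive1 L u0 else (L u - L u0) / (u - u0).
have cq : {for u0, continuous q}.
  have {}dL : h^-1 *: (L (h *: 1 + u0) - L u0) @[h --> 0^'] --> derive1 L u0.
    by rewrite derive1E; exact: dL.
  have qE : q u0 = derive1 L u0 by rewrite /q eqxx.
  apply/cvgrPdist_lt => e e0.
  move/cvgrPdist_lt : dL => /(_ e e0); rewrite !near_withinE => /nbhs_ballP[r r0 H].
  apply/nbhs_ballP; exists r => // u ur /=; rewrite qE /q.
  have [_|uu0] := eqVneq u u0; first by rewrite subrr normr0.
  have := H (u - u0); rewrite /ball/= sub0r opprB => /(_ ur).
  rewrite subr_eq0 => /(_ uu0); rewrite /GRing.scale/= mulr1 subrK.
  by rewrite mulrC.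
exists (fun z => (q (sqn z))%:C * conjc z0), (fun z => (q (sqn z))%:C * z).
split; [move=> z| | | |].
- have LE u : L u = L u0 + q u * (u - u0).
    rewrite /q; have [->|uu0] := eqVneq; first by rewrite subrr mulr0 addr0.
    by rewrite divfK ?subr_eq0// addrC subrK.
  rewrite {1}LE !rmorphD !rmorphM/= rmorphN rmorphB/= -!mul_conjc; ring.
- by apply: ctM; [exact: ct_radial|exact: ct_cst].
- by apply: ctM; [exact: ct_radial|exact: ct_id].
- by rewrite /q eqxx.
- by rewrite /q eqxx.
Qed.

(** Real and imaginary parts of [d/dx = A + B] and [d/dy = i (A - B)]. *)
Lemma cara_slopes F z0 A B : caratheodory F z0 A B ->
  slopes (fun x y => Re (F (Complex x y))) (Re z0) (Im z0) (Re A + Re B) (Im B - Im A) /\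
  slopes (fun x y => Im (F (Complex x y))) (Re z0) (Im z0) (Im A + Im B) (Re A - Re B).
Proof.
case: z0 => x0 y0 [P1 [P2 [FE c1 c2 <- <-]]] /=.
have ab (u v u' v' e : R) : `|u - u'| <= e / 2 -> `|v - v'| <= e / 2 ->
    `|u + v - (u' + v')| <= e /\ `|u - v - (u' - v')| <= e.
  rewrite !ler_norml => /andP[? ?] /andP[? ?].
  by split; apply/andP; split; lra.
have cts e : 0 < e -> exists2 d, 0 < d & forall x y, `|x - x0| <= d -> `|y - y0| <= d ->
    [/\ `|Re (P1 (Complex x y)) - Re (P1 (Complex x0 y0))| <= e / 2,
        `|Im (P1 (Complex x y)) - Im (P1 (Complex x0 y0))| <= e / 2,
        `|Re (P2 (Complex x y)) - Re (P2 (Complex x0 y0))| <= e / 2 &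
        `|Im (P2 (Complex x y)) - Im (P2 (Complex x0 y0))| <= e / 2].
  move=> e0; have e2 : 0 < e / 2 by rewrite divr_gt0.
  have [d1 d10 H1] := iffLR (ct_box _ _) (c1) _ e2.
  have [d2 d20 H2] := iffLR (ct_box _ _) (c2) _ e2.
  exists (Num.min d1 d2); first by rewrite lt_min d10.
  move=> x y; rewrite !le_min => /andP[x1 x2] /andP[y1 y2].
  by have [? ?] := H1 (Complex x y) x1 y1; have [? ?] := H2 (Complex x y) x2 y2.
split.
  exists (fun x y => Re (P1 (Complex x y)) + Re (P2 (Complex x y))),
    (fun x y => Im (P2 (Complex x y)) - Im (P1 (Complex x y))); split.
    by move=> x y; rewrite FE !ReImE/=; ring.
  move=> e /cts[d d0 H]; exists d => // x y hx hy; have [h1 h2 h3 h4] := H x y hx hy.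
  by split; [have [] := ab _ _ _ _ _ h1 h3|have [] := ab _ _ _ _ _ h4 h2].
exists (fun x y => Im (P1 (Complex x y)) + Im (P2 (Complex x y))),
  (fun x y => Re (P1 (Complex x y)) - Re (P2 (Complex x y))); split.
  by move=> x y; rewrite FE !ReImE/=; ring.
move=> e /cts[d d0 H]; exists d => // x y hx hy; have [h1 h2 h3 h4] := H x y hx hy.
by split; [have [] := ab _ _ _ _ _ h2 h4|have [] := ab _ _ _ _ _ h1 h3].
Qed.

Lemma slopesN (P : R -> R -> R) x y a b : slopes P x y a b -> slopes (fun x y => - P x y) x y (- a) (- b).
Proof.
move=> [p1 [p2 [Pe cv]]]; exists (fun x y => - p1 x y), (fun x y => - p2 x y); split.
  by move=> u v; rewrite Pe; ring.
move=> e /cv[d d0 H]; exists d => // u v hu hv; have [h1 h2] := H u v hu hv.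
by rewrite -!opprD !normrN.
Qed.

Section green.
Variables F B : C -> C.
Hypothesis cF : forall z, exists A, caratheodory F z A (B z).
Hypothesis cB : forall z, ctn_at B z.
Hypothesis F0 : forall z, sqn z >= 1 -> F z = 0.
Local Notation Q := (rect (-1) 1 (-1) 1).
Hypothesis iRe : pm.-integrable Q (EFin \o (fun p => Re (B (of_plane p)))).
Hypothesis iIm : pm.-integrable Q (EFin \o (fun p => Im (B (of_plane p)))).

Let zero_ge1 (x y : R) : `|x| = 1 \/ `|y| = 1 -> F (Complex x y) = 0.
Proof.
move=> h; apply: F0; rewrite /sqn/=; case: h => h.
  by rewrite -[x ^+ 2]real_normK ?num_real// h expr1n lerDl sqr_ge0.
by rewrite -[y ^+ 2]real_normK ?num_real// h expr1n lerDr sqr_ge0.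
Qed.

Let green (P Q : R -> R -> R) (T : C -> R) :
  (forall z, exists px py qx qy, [/\ slopes P (Re z) (Im z) px py,
     slopes Q (Re z) (Im z) qx qy & px + qy = 2 * T (B z)]) ->
  (forall z w, `|T (B z) - T (B w)| <= `|Re (B z) - Re (B w)| + `|Im (B z) - Im (B w)|) ->
  (forall x y, `|x| = 1 \/ `|y| = 1 -> P x y = 0 /\ Q x y = 0) ->
  pm.-integrable (rect (-1) 1 (-1) 1) (EFin \o (fun p => T (B (of_plane p)))) ->
  \int[pm]_(p in rect (-1) 1 (-1) 1) T (B (of_plane p)) = 0.
Proof.
move=> sl Tc PQ0 iT.
have E1 : -1 + 2 = 1 :> R by ring.
have i2 : pm.-integrable (rect (-1) (-1 + 2) (-1) (-1 + 2)) (EFin \o (fun p => 2 * T (B (of_plane p)))).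
  rewrite E1 (_ : EFin \o _ = (fun p => 2%:E * (T (B (of_plane p)))%:E)%E)//.
  exact: (integrableZl (measurable_rect _ _ _ _) _ iT).
have := @goursat R P Q (fun p => 2 * T (B (of_plane p))) (-1) 2 (ltr0Sn _ 1) (fun x y => sl (Complex x y)) _ i2.
rewrite /flux E1.
have n1 : `|1| = 1 :> R by rewrite normr1.
have nN1 : `|-1| = 1 :> R by rewrite normrN1.
rewrite (_ : (fun y => P 1 y - P (-1) y) = cst 0); last first.
  by apply/funext => y; rewrite (PQ0 1 y _).1 ?(PQ0 (-1) y _).1 ?subrr//; left.
rewrite (_ : (fun x => Q x 1 - Q x (-1)) = cst 0); last first.
  by apply/funext => x; rewrite (PQ0 x 1 _).2 ?(PQ0 x (-1) _).2 ?subrr//; right.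
rewrite !Rintegral_cst// !mul0r addr0 sub0r RintegralZl//; last exact: measurable_rect.
move=> H; apply/eqP; suff : - (2 * \int[pm]_(p in rect (-1) 1 (-1) 1) T (B (of_plane p))) = 0.
  by move/eqP; rewrite oppr_eq0 mulf_eq0 pnatr_eq0.
(* By [Tc], [T] moves by at most the sum of two coordinate variations, and the divergence is
   [2 * T]: hence [e / 4]. *)
apply: H => x y e e0; have e4 : 0 < e / 4 by rewrite divr_gt0.
have [d d0 H] := iffLR (ct_box _ _) (cB (Complex x y)) _ e4.
exists d => // x' y' hx hy; have [h1 h2] := H (Complex x' y') hx hy.
rewrite -mulrBr normrM (@ger0_norm _ 2)//.
have := Tc (Complex x' y') (Complex x y); rewrite /of_plane/=; move: h1 h2; lra.
Qed.

(** For [F = u + i v], the fields [(u, - v)] and [(v, u)] have divergences [2 Re B] and [2 Im B].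
    The square has its boundary outside the open disc, where [F] vanishes, so both boundary fluxes
    are zero. *)
Lemma dbar_integral0 :
  \int[pm]_(p in rect (-1) 1 (-1) 1) Re (B (of_plane p)) = 0 /\
  \int[pm]_(p in rect (-1) 1 (-1) 1) Im (B (of_plane p)) = 0.
Proof.
split.
  apply: (@green (fun x y => Re (F (Complex x y))) (fun x y => - Im (F (Complex x y)))) => //.
  - move=> z; have [A /cara_slopes[s1 /slopesN s2]] := cF z.
    do 4 eexists; split; [exact: s1|exact: s2|ring].
  - by move=> z w; rewrite lerDl.
  - by move=> x y /zero_ge1 ->; rewrite oppr0.
apply: (@green (fun x y => Im (F (Complex x y))) (fun x y => Re (F (Complex x y)))) => //.
- move=> z; have [A /cara_slopes[s1 s2]] := cF z.
  do 4 eexists; split; [exact: s2|exact: s1|ring].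
- by move=> z w; rewrite lerDr.
- by move=> x y /zero_ge1 ->.
Qed.

End green.
End Dbar.

(** * Radial weights against analytic functions *)

Section Radial.
Context {R : realType}.
Local Notation C := R[i].
Local Notation lam := (@lebesgue_measure R).
Local Notation pm := (@plane_measure R).
Local Notation D := (@plane_disc R).
Local Notation Re := (@complex.Re R).
Local Notation Im := (@complex.Im R).
Local Notation "x %:C" := (real_complex R x).
Variable alpha : R.
Hypothesis alpha_gt : -1 < alpha.
Implicit Types (f F G : C -> C) (chi : R -> R) (l i : nat).
Local Notation dI := (disc_integral alpha).

(** Vanishing near 1 tames [(1 - u)^alpha], and vanishing near 0 absorbs the pole of [z^(-l-1)]. *)
Definition is_bump chi := continuous chi /\
  exists2 d, 0 < d & forall u, u <= d \/ 1 - d <= u -> chi u = 0.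

Definition radial_weight (u : R) : R := (1 - u) `^ alpha.

Lemma continuous_w u : u < 1 -> {for u, continuous radial_weight}.
Proof.
move=> u1; rewrite /radial_weight; have u0 : 0 < 1 - u by rewrite subr_gt0.
apply: (@cvg_comp _ _ _ (fun u => 1 - u) (fun x => x `^ alpha) _ (nbhs (1 - u))).
  by apply: cvgB; [exact: cvg_cst|exact: cvg_id].
apply: (@differentiable_continuous _ _ _ (1 - u) (fun x => x `^ alpha)).
by apply/derivable1_diffP; have [] := is_derive1_powR alpha u0.
Qed.

(** From [u = 1] on the values of the power are irrelevant: [chi] is zero on a whole neighbourhood,
    so the product is locally zero. *)
Lemma continuous_bump chi : is_bump chi -> continuous (fun u => radial_weight u * chi u).
Proof.
move=> [cchi [d d0 chi0]] u; have [u1|u1] := ltP u 1.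
  by apply: cvgM; [exact: continuous_w|exact: cchi].
rewrite /continuous_at chi0 ?mulr0; last by right; lra.
have : (fun _ : R => 0 : R) t @[t --> u] --> (0 : R) by exact: cvg_cst.
apply: cvg_trans.
apply: near_eq_cvg; near=> t; rewrite /= chi0 ?mulr0//; right; apply: ltW.
near: t; apply: lt_nbhsr; lra.
Unshelve. all: by end_near. Qed.

Definition bump_moment l chi : R := \int[lam]_(u in `[0, 1]) (u ^+ l * (radial_weight u * chi u)).

Lemma continuous_bump_moment_integrand l chi : is_bump chi -> continuous (fun u : R => u ^+ l * (radial_weight u * chi u)).
Proof.
move=> bchi u; apply: cvgM; last exact: continuous_bump.
exact: exprn_continuous.
Qed.

Lemma integrable_seg (h : R -> R) a b : continuous h -> lam.-integrable `[a, b] (EFin \o h).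
Proof.
move=> ch; apply: continuous_compact_integrable; first exact: segment_compact.
by apply: continuous_subspaceT => x; exact: ch.
Qed.

Lemma bumpZ k chi : is_bump chi -> is_bump (fun u => k * chi u).
Proof.
move=> [c [d d0 H]]; split; last by exists d => // u /H ->; rewrite mulr0.
by move=> u; apply: cvgM; [exact: cvg_cst|exact: c].
Qed.

Lemma bumpD chi chi' : is_bump chi -> is_bump chi' -> is_bump (fun u => chi u + chi' u).
Proof.
move=> [c [d d0 H]] [c' [d' d0' H']]; split.
  by move=> u; apply: cvgD; [exact: c|exact: c'].
exists (Num.min d d'); first by rewrite lt_min d0.
move=> u [|h]; first by rewrite le_min => /andP[h1 h2]; rewrite H ?H' ?addr0//; left.
have [/= m1 m2] : Num.min d d' <= d /\ Num.min d d' <= d' by rewrite !ge_min !lexx orbT.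
by rewrite H ?H' ?addr0//; right; lra.
Qed.

Lemma bumpX i chi : is_bump chi -> is_bump (fun u : R => u ^+ i * chi u).
Proof.
move=> [c [d d0 H]]; split; last by exists d => // u /H ->; rewrite mulr0.
by move=> u; apply: cvgM; [exact: exprn_continuous|exact: c].
Qed.

Lemma bump_momentZ l k chi : is_bump chi -> bump_moment l (fun u => k * chi u) = k * bump_moment l chi.
Proof.
move=> b; rewrite /bump_moment -RintegralZl//; last by apply: integrable_seg; exact: continuous_bump_moment_integrand.
by apply: eq_Rintegral => u _; ring.
Qed.

Lemma bump_momentD l chi chi' : is_bump chi -> is_bump chi' ->
  bump_moment l (fun u => chi u + chi' u) = bump_moment l chi + bump_moment l chi'.
Proof.
move=> b b'; rewrite /bump_moment -RintegralD//; try by apply: integrable_seg; exact: continuous_bump_moment_integrand.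
by apply: eq_Rintegral => u _; ring.
Qed.

Section primitive.
Variables (l : nat) (chi : R -> R).
Hypothesis bchi : is_bump chi.
Let g u := u ^+ l * (radial_weight u * chi u).
(** Starting left of 0, where [chi] vanishes, makes every [u >= 0] an interior point for the
    fundamental theorem of calculus. *)
Definition bump_primitive (u : R) := \int[lam]_(t in `[-1, u]) g t.

Lemma prim_derivable u : -1 < u -> derivable bump_primitive u 1 /\ derive1 bump_primitive u = g u.
Proof.
move=> u1; apply: (@continuous_FTC1_closed R g (-1) u (u + 1)) => //.
- by rewrite ltrDl.
- by apply: integrable_seg; exact: continuous_bump_moment_integrand.
- exact: continuous_bump_moment_integrand.
Qed.

Lemma prim_near0 : exists2 d, 0 < d & forall u, u <= d -> bump_primitive u = 0.
Proof.
have [_ [d d0 H]] := bchi; exists d => // u ud; rewrite /bump_primitive.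
rewrite (@eq_Rintegral _ _ _ _ _ (cst 0)) ?Rintegral_cst ?mul0r//.
by move=> t; rewrite inE/= in_itv/= /g => /andP[_ tu]; rewrite H ?mulr0//; left; exact: le_trans ud.
Qed.

(** Near 1 and beyond, the integral over [[-1, u]] differs from the moment over [[0, 1]] only where
    [chi] is zero. *)
Lemma prim_near1 : bump_moment l chi = 0 -> exists2 d, 0 < d & forall u, 1 - d <= u -> bump_primitive u = 0.
Proof.
move=> k0; have [_ [d d0 H]] := bchi; exists d => // u ud; rewrite /bump_primitive -k0 /bump_moment.
rewrite Rintegral_mkcond [RHS]Rintegral_mkcond; congr Rintegral; apply/funext => t.
rewrite !patchE; case: ifPn => [_|]; case: ifPn => //.
  rewrite notin_setE/= in_itv/= => /negP; rewrite negb_and -!ltNge /g => /orP[t0|t1].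
    by rewrite H ?mulr0//; left; lra.
  by rewrite H ?mulr0//; right; lra.
rewrite inE/= in_itv/= => /andP[t0 t1]; rewrite notin_setE/= in_itv/= => /negP.
rewrite negb_and -!ltNge => /orP[|tu]; first lra.
by rewrite H ?mulr0//; right; lra.
Qed.
End primitive.

Lemma rect_disc p : D p -> rect (-1) 1 (-1) 1 p.
Proof.
move=> /plane_discP; rewrite /plane_sqn /rect/= !in_itv/= => h.
have h1 : `|p.1| < 1.
  by rewrite -(@ltr_sqr _ `|p.1|) ?nnegrE// expr1n real_normK ?num_real//; apply: le_lt_trans h; rewrite lerDl sqr_ge0.
have h2 : `|p.2| < 1.
  by rewrite -(@ltr_sqr _ `|p.2|) ?nnegrE// expr1n real_normK ?num_real//; apply: le_lt_trans h; rewrite lerDr sqr_ge0.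
by move: h1 h2; rewrite !ltr_norml => /andP[/ltW -> ->] /andP[/ltW -> ->].
Qed.

Lemma pm_disc_fin : (pm D < +oo)%E.
Proof.
apply: (@le_lt_trans _ _ (pm (rect (-1) 1 (-1) 1))).
  by apply: le_measure; rewrite ?inE//; [exact: measurable_rect|move=> p; exact: rect_disc].
by rewrite pm_rect ?ltry//; lra.
Qed.

Definition bump_mul f l chi : C -> C := fun z => f z * conjc z ^+ l * (chi (sqn z))%:C.

Lemma vanish_patch (h : R * R -> R) (A : set (R * R)) :
  (forall p, ~ A p -> h p = 0) -> h \_ A = h.
Proof.
move=> h0; apply/funext => p; rewrite patchE; case: ifPn => //.
by rewrite notin_setE => /h0.
Qed.

(* With [u = |z|^2] and [L] the primitive of [u^l (1 - u)^alpha chi(u)], the function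
   [f z^(-l-1) L(u)] is compactly supported in the punctured disc, because the moment
   of [chi] vanishes; its dbar-derivative is [f zbar^l (1 - u)^alpha chi(u)]. *)
Lemma bump_mul_integral0 f l chi : analytic_on_disc f -> is_bump chi -> bump_moment l chi = 0 ->
  cintegrable alpha (bump_mul f l chi) -> dI (bump_mul f l chi) = 0.
Proof.
move=> af bchi k0 [mG iRe iIm].
have a0 : 0 < 1 + alpha by rewrite -ltrBlDl sub0r.
have [cchi [d d0 chi0]] := bchi.
pose B z := f z * conjc z ^+ l * (radial_weight (sqn z) * chi (sqn z))%:C.
pose F z := f z * z^-1 ^+ l.+1 * (bump_primitive l chi (sqn z))%:C.
have chi1 z : 1 <= sqn z -> chi (sqn z) = 0 by move=> h; apply: chi0; right; lra.
have dz z : 0 < sqn z < 1 -> exists A, caratheodory (fun z => f z * z^-1 ^+ l.+1) z A 0.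
  move=> /andP[z0 z1]; have zn0 : z != 0.
    by apply: contraTneq z0 => ->; rewrite /sqn/= expr0n addr0 ltxx.
  have [A1 c1] : exists A, caratheodory f z A 0.
    by apply: cara_derivable; apply: af; rewrite unit_discE.
  have [A2 c2] : exists A, caratheodory (fun z => z^-1 ^+ l.+1) z A 0.
    by have [A' /caraX] := cara_inv zn0; exact.
  eexists; move: (caraM c1 c2); rewrite !mul0r mulr0 addr0; exact.
have [d1 d10 H1] := prim_near0 l bchi.
have [d2 d20 H2] := prim_near1 bchi k0.
have near_u z (P : C -> Prop) (e : R) : 0 < e -> (forall z', `|sqn z' - sqn z| <= e -> P z') ->
    \forall z' \near (z : C^o), P z'.
  move=> e0 H; apply/near_boxP; have [d' d'0 H'] := iffLR (ct_box _ _) (ct_sqn z) _ e0.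
  by exists d' => // z' hx hy; apply: H; have [] := H' z' hx hy.
(* At the origin and outside the open disc, [F] and [B] are locally zero, so the pole of [z^(-l-1)]
   and the boundary need no further analysis. *)
have near0 z : ~ (0 < sqn z < 1) -> \forall z' \near (z : C^o), F z' = 0 /\ B z' = 0.
  move=> hz; have [z0|z0] := leP (sqn z) 0.
    have m0 : 0 < Num.min d d1 by rewrite lt_min d0.
    apply: (near_u z _ _ m0) => z'; rewrite le_min !ler_norml => /andP[/andP[_ h1] /andP[_ h2]].
    by rewrite /F /B H1 ?chi0 ?mulr0//; [left|]; lra.
  have z1 : 1 <= sqn z by rewrite leNgt; apply/negP => h; apply: hz; rewrite z0.
  have m0 : 0 < Num.min d d2 by rewrite lt_min d0.
  apply: (near_u z _ _ m0) => z'; rewrite le_min !ler_norml => /andP[/andP[h1 _] /andP[h2 _]].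
  by rewrite /F /B H2 ?chi0 ?mulr0//; [right|]; lra.
have cF z : exists A, caratheodory F z A (B z).
  have [h|h] := boolP (0 < sqn z < 1).
    have /andP[z0 z1] := h; have zn0 : z != 0.
      by apply: contraTneq z0 => ->; rewrite /sqn/= expr0n addr0 ltxx.
    have [A1 c1] := dz z h.
    have [dp pE] : derivable (bump_primitive l chi) (sqn z) 1 /\
      derive1 (bump_primitive l chi) (sqn z) = sqn z ^+ l * (radial_weight (sqn z) * chi (sqn z)).
      by apply: prim_derivable => //; apply: lt_trans z0; rewrite ltrN10.
    have := caraM c1 (cara_radial dp); rewrite pE => c2.
    (* Since [|z|^2 = z zbar], one has [z^(-l-1) |z|^(2l) z = zbar^l]. *)
    suff -> : B z = f z * z^-1 ^+ l.+1 * ((sqn z ^+ l * (radial_weight (sqn z) * chi (sqn z)))%:C * z).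
      by eexists; move: c2; rewrite mul0r add0r; exact.
    rewrite /B (rmorphM _ (_ ^+ _)) rmorphXn/= -mul_conjc exprMn exprS !exprVn.
    set c := (_ * _)%:C; rewrite -!mulrA; congr (_ * _).
    by field; rewrite expf_neq0 ?zn0.
  have hn := near0 z (elimN idP h).
  have [_ B0] := nbhs_singleton hn.
  have dF : derivable (F : C^o -> C^o) z 1.
    apply: (@near_eq_derivable C C^o C^o (cst 0)); last exact: derivable_cst.
    by apply: filterS hn => z' [-> _].
  rewrite B0; exact: cara_derivable.
have cB z : ctn_at B z.
  have [/andP[z0 z1]|h] := boolP (0 < sqn z < 1).
    apply: ctM; last by apply: (@ct_radial _ (fun u => radial_weight u * chi u)); exact: continuous_bump.
    apply: ctM; last by apply: ctX; exact: ctJ.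
    have [A] : exists A, caratheodory f z A 0.
      by apply: cara_derivable; apply: af; rewrite unit_discE.
    exact: cara_ct.
  have hn := near0 z (elimN idP h).
  apply: (@ct_near _ (fun=> 0)); last exact: ct_cst.
  by apply: filterS hn => z' [_ ->].
have F1 z : sqn z >= 1 -> F z = 0.
  by move=> z1; rewrite /F H2 ?mulr0//; lra.
have GB (T : C -> R) : (forall (x : R) z, T (z * x%:C) = T z * x) ->
    forall p, T (bump_mul f l chi (of_plane p)) * dens alpha p = (1 + alpha) / pi * T (B (of_plane p)).
  by move=> TZ p; rewrite /bump_mul /B densE !TZ sqn_plane /radial_weight; ring.
have TRe (x : R) z : Re (z * x%:C) = Re z * x by rewrite cReM/= mulr0 subr0.
have TIm (x : R) z : Im (z * x%:C) = Im z * x by rewrite cImM/= mulr0 add0r.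
have c0 : (1 + alpha) / pi != 0 by rewrite mulf_neq0 ?invr_neq0 ?gt_eqF ?pi_gt0.
pose Q : set (R * R) := rect (-1) 1 (-1) 1.
(* [B] carries the power [(1 - u)^alpha] but not the constant [(1 + alpha) / pi], and vanishes off
   the disc; so the weighted integral over the disc becomes a plain integral over the square. *)
have onQ (T : C -> R) : (forall (x : R) z, T (z * x%:C) = T z * x) ->
    dens_integrable alpha (fun p => T (bump_mul f l chi (of_plane p))) ->
    pm.-integrable Q (EFin \o (fun p => T (B (of_plane p)))) /\
    \int[pm]_(p in D) (T (bump_mul f l chi (of_plane p)) * dens alpha p) =
    (1 + alpha) / pi * \int[pm]_(p in Q) T (B (of_plane p)).
  move=> TZ iG; pose h p := T (B (of_plane p)).
  have hD p : ~ D p -> h p = 0.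
    move=> /plane_discP/negP; rewrite -leNgt -sqn_plane => /chi1 e.
    by rewrite /h /B e mulr0 TZ mulr0.
  have hQ p : ~ Q p -> h p = 0 by move=> nQ; apply: hD => /rect_disc.
  have iD : pm.-integrable D (EFin \o h).
    rewrite (_ : EFin \o h = fun p => (((1 + alpha) / pi)^-1)%:E *
       (T (bump_mul f l chi (of_plane p)) * dens alpha p)%:E)%E.
      exact: (integrableZl measurable_disc _ iG).
    by apply/funext => p /=; rewrite (GB T TZ) -EFinM mulKf.
  have iT : pm.-integrable setT (EFin \o h).
    by move: iD => /(integrable_mkcond _ measurable_disc); rewrite restrict_EFin vanish_patch.
  split; first by apply: integrableS iT => //; exact: measurable_rect.
  under eq_Rintegral do rewrite (GB T TZ).
  rewrite RintegralZl//; congr (_ * _).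
  by rewrite Rintegral_mkcond [RHS]Rintegral_mkcond !vanish_patch.
have [i1 e1] := onQ Re TRe iRe.
have [i2 e2] := onQ Im TIm iIm.
have [r1 r2] := dbar_integral0 cF cB F1 i1 i2.
by rewrite disc_integralE e1 e2 r1 r2 !mulr0.
Qed.

(** The combination of [chi] and [chi0] weighted by each other's moments has moment zero, so
    [bump_mul_integral0] applies to it. *)
Lemma bump_mul_integral f l chi chi0 : analytic_on_disc f -> is_bump chi -> is_bump chi0 ->
  cintegrable alpha (bump_mul f l chi) -> cintegrable alpha (bump_mul f l chi0) ->
  (bump_moment l chi0)%:C * dI (bump_mul f l chi) = (bump_moment l chi)%:C * dI (bump_mul f l chi0).
Proof.
move=> af b b0 c c0.
set k0 := bump_moment l chi0; set k := bump_moment l chi.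
pose chi' u := k0 * chi u + - k * chi0 u.
have b' : is_bump chi' by apply: bumpD; exact: bumpZ.
have GE : bump_mul f l chi' = fun z => k0%:C * bump_mul f l chi z + (- k)%:C * bump_mul f l chi0 z.
  by apply/funext => z; rewrite /bump_mul rmorphD !rmorphM/=; ring.
have ci : cintegrable alpha (bump_mul f l chi') by rewrite GE; apply: cintD; exact: cintZ.
have := bump_mul_integral0 af b' _ ci; rewrite GE disc_integralD//; try exact: cintZ.
rewrite !disc_integralZ//= rmorphN mulNr => H; apply/eqP; rewrite -subr_eq0; apply/eqP; apply: H.
by rewrite bump_momentD ?bump_momentZ//; [rewrite -/k0 -/k; ring|exact: bumpZ|exact: bumpZ].
Qed.

End Radial.

(** * Cutoffs *)

Section Cutoffs.
Context {R : realType}.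
Local Notation C := R[i].
Local Notation lam := (@lebesgue_measure R).
Local Notation pm := (@plane_measure R).
Local Notation T2 := (measurableTypeR R * measurableTypeR R)%type.
Local Notation mfun := (@measurable_fun _ _ T2 R plane_disc).
Local Notation D := (@plane_disc R).
Variable alpha : R.
Hypothesis alpha_gt : -1 < alpha.
Implicit Types (f F G : C -> C) (chi : R -> R) (l i : nat).

(** The truncation of [t] to [[0, 1]], written with absolute values so that continuity comes from
    that of the norm. *)
Definition clamp (t : R) : R := (1 + `|t| - `|1 - t|) / 2.

Lemma clamp_le0 t : t <= 0 -> clamp t = 0.
Proof.
move=> t0; rewrite /clamp ler0_norm// ger0_norm; last by rewrite subr_ge0; lra.
by rewrite (_ : 1 + - t - (1 - t) = 0) ?mul0r//; ring.
Qed.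

Lemma clamp_ge1 t : 1 <= t -> clamp t = 1.
Proof.
move=> t1; rewrite /clamp ger0_norm; last by lra.
rewrite ler0_norm; last by rewrite subr_le0.
by field.
Qed.

Lemma clamp_mid t : 0 <= t -> t <= 1 -> clamp t = t.
Proof.
move=> t0 t1; rewrite /clamp ger0_norm// ger0_norm; last by rewrite subr_ge0.
by field.
Qed.

Lemma clamp_itv t : 0 <= clamp t <= 1.
Proof.
have [/clamp_le0 ->|t0] := leP t 0; first by rewrite lexx ler01.
have [/clamp_ge1 ->|t1] := leP 1 t; first by rewrite lexx ler01.
by rewrite clamp_mid ?ltW// t0.
Qed.

Lemma clamp_mono t s : t <= s -> clamp t <= clamp s.
Proof.
move=> ts; have [/clamp_le0 ->|t0] := leP t 0; first by have /andP[] := clamp_itv s.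
have [/clamp_ge1 ->|s1] := leP 1 s; first by have /andP[] := clamp_itv t.
by rewrite !clamp_mid//; lra.
Qed.

Lemma continuous_clamp (h : R -> R) : continuous h -> continuous (clamp \o h).
Proof.
move=> ch u; apply: cvgM; last exact: cvg_cst.
apply: cvgB; first by apply: cvgD; [exact: cvg_cst|apply: cvg_norm; exact: ch].
by apply: cvg_norm; apply: cvgB; [exact: cvg_cst|exact: ch].
Qed.

(** Zero for [u <= 1/N] and [u >= 1 - 1/N], and equal to 1 on [[2/N, 1 - 2/N]]. *)
Definition cutN (N : nat) (u : R) := clamp (N%:R * u - 1) * clamp (N%:R * (1 - u) - 1).

Lemma cut_itv N u : 0 <= cutN N u <= 1.
Proof.
have /andP[a0 a1] := clamp_itv (N%:R * u - 1).
have /andP[b0 b1] := clamp_itv (N%:R * (1 - u) - 1).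
by rewrite mulr_ge0//= mulr_ile1.
Qed.

Lemma cut_bump N : is_bump (cutN N).
Proof.
have N0 : 0 < N.+1%:R :> R by rewrite ltr0n.
(* The margin [1 / (N + 1)] instead of [1 / N] also covers [N = 0], where the cutoff is identically
   zero. *)
have small (u : R) : u <= N.+1%:R^-1 -> N%:R * u - 1 <= 0.
  move=> uN; rewrite subr_le0; have [u0|u0] := leP u 0.
    by rewrite (le_trans _ ler01)// mulr_ge0_le0.
  rewrite (le_trans (ler_wpM2l _ uN))// ler_pdivrMr// mul1r ler_nat.
  exact: leqnSn.
split; last first.
  exists N.+1%:R^-1; first by rewrite invr_gt0.
  move=> u [/small h|h]; rewrite /cutN; first by rewrite clamp_le0 ?mul0r.
  by rewrite [X in _ * X]clamp_le0 ?mulr0//; apply: small; move: h; rewrite !lerBlDr addrC.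
move=> u; apply: cvgM.
  apply: (@continuous_clamp (fun u => N%:R * u - 1)) => v.
  by apply: cvgB; [apply: cvgM; [exact: cvg_cst|exact: cvg_id]|exact: cvg_cst].
apply: (@continuous_clamp (fun u => N%:R * (1 - u) - 1)) => v.
apply: cvgB; last exact: cvg_cst.
by apply: cvgM; [exact: cvg_cst|apply: cvgB; [exact: cvg_cst|exact: cvg_id]].
Qed.

Lemma cut_mono u : 0 <= u <= 1 -> {homo (fun N => cutN N u) : n m / (n <= m)%N >-> n <= m}.
Proof.
move=> /andP[u0 u1] n m nm; rewrite /cutN.
have /andP[a0 _] := clamp_itv (n%:R * u - 1).
have /andP[b0 _] := clamp_itv (n%:R * (1 - u) - 1).
apply: ler_pM => //; apply: clamp_mono; rewrite lerD2r ler_wpM2r ?ler_nat//.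
by rewrite subr_ge0.
Qed.

(** The plateau [[2/8, 6/8]] makes [cutN 8] a fixed reference bump with positive moments. *)
Lemma cut8 u : 1 / 4 <= u <= 3 / 4 -> cutN 8 u = 1.
Proof. by move=> /andP[h1 h2]; rewrite /cutN !clamp_ge1 ?mulr1//; lra. Qed.

Lemma cut_cvg u : 0 < u < 1 -> cutN N u @[N --> \oo] --> (1 : R).
Proof.
move=> /andP[u0 u1].
have big (v : R) : 0 < v -> \forall N \near \oo, 1 <= N%:R * v - 1.
  move=> v0; near=> N; rewrite lerBrDr -ler_pdivrMr//.
  by near: N; exact: nbhs_infty_ger.
have v0 : 0 < 1 - u by rewrite subr_gt0.
have : (fun _ : nat => 1 : R) N @[N --> \oo] --> (1 : R) by exact: cvg_cst.
apply: cvg_trans; apply: near_eq_cvg; near=> N.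
rewrite /cutN !clamp_ge1 ?mulr1//; near: N; exact: big.
Unshelve. all: by end_near. Qed.

Lemma Rintegral_gt0 d (T : measurableType d) (mu : {measure set T -> \bar R})
  (A E : set T) (h : T -> R) :
  measurable A -> measurable E -> mu.-integrable A (EFin \o h) ->
  (forall x, A x -> 0 <= h x) -> E `<=` A -> (forall x, E x -> 0 < h x) ->
  (0 < mu E)%E -> 0 < \int[mu]_(x in A) h x.
Proof.
move=> mA mE ih h0 EA hE muE.
rewrite lt_neqAle Rintegral_ge0// andbT eq_sym; apply/negP => /eqP I0.
have [mh _] := (elimT (integrableP _ _ _) ih).
have : (\int[mu]_(x in A) `|(EFin \o h) x| = 0)%E.
  rewrite -[RHS](_ : (\int[mu]_(x in A) h x)%:E = 0%E); last by rewrite I0.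
  rewrite /Rintegral fineK; last exact: integrable_fin_num.
  by apply: eq_integral => x; rewrite inE => /h0 hx; rewrite gee0_abs.
move=> /(ae_eq_integral_abs mu mA mh)[N [mN N0 sub]].
move: muE; rewrite lt0e => /andP[/eqP + _]; apply.
apply/eqP; rewrite eq_le measure_ge0 andbT -N0.
apply: le_measure; rewrite ?inE// => x Ex; apply: sub => /= /(_ (EA _ Ex)) [].
by move/eqP; rewrite gt_eqF// hE.
Qed.

Lemma bump_moment_cut8_gt0 l : 0 < bump_moment alpha l (cutN 8).
Proof.
rewrite /bump_moment; apply: (@Rintegral_gt0 _ (measurableTypeR R) lam _ `[1 / 4, 3 / 4]%classic) => //.
- by apply: integrable_seg; apply: continuous_bump_moment_integrand; exact: cut_bump.
- move=> u; rewrite /= in_itv/= => /andP[u0 u1].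
  by have /andP[c0 _] := cut_itv 8 u; apply: mulr_ge0; [exact: exprn_ge0|apply: mulr_ge0 => //; exact: powR_ge0].
- by move=> u /=; rewrite !in_itv/= => /andP[u0 u1]; apply/andP; split; lra.
- move=> u /=; rewrite in_itv/= => uI; rewrite cut8// mulr1.
  move/andP: uI => [u0 u1]; apply: mulr_gt0; [apply: exprn_gt0|apply: powR_gt0]; lra.
- have l0 : (0 < lam `[(1 / 4)%R, (3 / 4)%R]%classic)%E.
    by rewrite lebesgue_measure_itv/= lte_fin ifT ?lte_fin; lra.
  exact: l0.
Qed.

Definition weighted_integral (h : R * R -> R) := \int[pm]_(p in D) (h p * dens alpha p).

Lemma measurable_radial (h : R -> R) : measurable_fun setT h -> mfun (h \o plane_sqn).
Proof.
move=> mh; apply: (@measurable_funS _ _ T2 R setT) => //.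
by apply: (measurableT_comp mh); exact: measurable_u2.
Qed.

(** The density alone may be unbounded, but its product with a bump is continuous in [|z|^2], hence
    bounded on [[0, 1]]. *)
Lemma bump_rint chi : is_bump chi -> dens_integrable alpha (chi \o plane_sqn).
Proof.
move=> bchi; have cw := continuous_bump (alpha := alpha) bchi.
have [M HM] : exists M, forall u, 0 <= u <= 1 -> `|radial_weight alpha u * chi u| <= M.
  have [|c _ Hc] := @EVT_max R (fun u => `|radial_weight alpha u * chi u|) 0 1 ler01.
    by apply: continuous_subspaceT => u; apply: cvg_norm; exact: cw.
  by exists (`|radial_weight alpha c * chi c|) => u uI; apply: Hc; rewrite in_itv.
apply: (@bounded_integrable _ _ _ _ _ _ (`|(1 + alpha) / pi| * M)).
- exact: measurable_disc.
- exact: pm_disc_fin.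
- apply: measurable_funM; last exact: measurable_densD.
  by apply: measurable_radial; apply: continuous_measurable_fun; case: bchi.
- move=> p /plane_discP/ltW up.
  have up0 : 0 <= plane_sqn p by rewrite addr_ge0 ?sqr_ge0.
  rewrite densE (_ : _ * _ = (1 + alpha) / pi * (radial_weight alpha (plane_sqn p) * chi (plane_sqn p))).
    by rewrite normrM ler_wpM2l// HM// up0.
  by rewrite /radial_weight/=; ring.
Qed.

(** The bound is the integral of [(1 - u)^alpha] over [[0, 1]], finite because [alpha > -1].
    Stopping at [1 - d], where the cutoff is already zero, keeps the antiderivative away from the
    singularity. *)
Lemma bump_moment_cut_le N : bump_moment alpha 0 (cutN N) <= (1 + alpha)^-1.
Proof.
have a0 : 0 < 1 + alpha by rewrite -ltrBlDl sub0r.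
have [_ [d0 d00 H]] := cut_bump N.
have [d [d_gt0 d1 {}H]] : exists d, [/\ 0 < d, d < 1 & forall u, 1 - d <= u -> cutN N u = 0].
  (* The minimum with [1 / 2] guarantees [0 < 1 - d]. *)
  exists (Num.min d0 (1 / 2)); split.
  - by rewrite lt_min d00 divr_gt0.
  - by rewrite gt_min; apply/orP; right; lra.
  - move=> u; have : Num.min d0 (1 / 2) <= d0 by rewrite ge_min lexx.
    by move=> h1 h2; apply: H; right; lra.
pose F (u : R) : R := - (1 + alpha)^-1 * (1 - u) `^ (1 + alpha).
have dF (u : R) : u < 1 -> is_derive u 1 F (radial_weight alpha u).
  move=> u1; have u10 : 0 < 1 - u by rewrite subr_gt0.
  have i1 : is_derive u 1 (fun u : R => 1 - u) (-1).
    by rewrite -[X in is_derive _ _ _ X]sub0r; apply: is_deriveB.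
  have := @is_derive1_comp R (fun x => x `^ (1 + alpha)) (fun u => 1 - u) u _ _ (is_derive1_powR (1 + alpha) u10) i1.
  move=> i2; have := is_deriveZ (- (1 + alpha)^-1) i2.
  rewrite /GRing.scale/= (_ : 1 + alpha - 1 = alpha); last ring.
  rewrite mulrN1 mulrN mulNr opprK mulrA mulVf ?mul1r ?gt_eqF//; exact.
have cF (u : R) : u < 1 -> {for u, continuous F}.
  move=> u1; apply: differentiable_continuous; apply/derivable1_diffP.
  by have [] := dF u u1.
have cw u : u < 1 -> {for u, continuous (radial_weight alpha)} by exact: continuous_w.
have b1 : 1 - d < 1 by rewrite ltrBlDr ltrDl.
have b0 : 0 < 1 - d by rewrite subr_gt0.
have wc : {within `[0, 1 - d], continuous (radial_weight alpha)}.
  apply: continuous_in_subspaceT => u; rewrite inE/= in_itv/= => /andP[_ ub].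
  by apply: cw; exact: le_lt_trans b1.
have I1 : \int[lam]_(u in `[0, 1 - d]) radial_weight alpha u = F (1 - d) - F 0.
  rewrite /Rintegral (@continuous_FTC2 _ _ F 0 (1 - d))//.
    split.
    - by move=> u; rewrite in_itv/= => /andP[_ ub]; have [] := dF u (lt_trans ub b1).
    - by apply: cvg_at_right_filter; apply: cF; exact: ltr01.
    - by apply: cvg_at_left_filter; exact: cF.
  by move=> u; rewrite in_itv/= => /andP[_ ub]; rewrite derive1E; have [_ ->] := dF u (lt_trans ub b1).
rewrite /bump_moment.
have ci := @continuous_bump_moment_integrand R alpha 0 _ (cut_bump N).
have -> : \int[lam]_(u in `[0, 1]) (u ^+ 0 * (radial_weight alpha u * cutN N u)) =
          \int[lam]_(u in `[0, 1 - d]) (u ^+ 0 * (radial_weight alpha u * cutN N u)).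
  rewrite Rintegral_mkcond [RHS]Rintegral_mkcond; congr Rintegral; apply/funext => t.
  rewrite !patchE; case: ifPn => [|]; case: ifPn => //.
    rewrite notin_setE/= in_itv/= => /negP; rewrite negb_and -!ltNge => /orP[t0|t1].
      by rewrite inE/= in_itv/= => /andP[t0' _]; lra.
    by rewrite H ?mulr0//; lra.
  rewrite inE/= in_itv/= => /andP[t0 t1]; rewrite notin_setE/= in_itv/= => /negP.
  by rewrite negb_and -!ltNge => /orP[|tu]; lra.
have F0 : F 0 = - (1 + alpha)^-1 by rewrite /F subr0 powR1 mulr1.
apply: (@le_trans _ _ (F (1 - d) - F 0)).
  rewrite -I1; apply: le_Rintegral => //.
  - exact: integrable_seg.
  - by apply: continuous_compact_integrable; [exact: segment_compact|exact: wc].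
  - move=> u _; rewrite expr0 mul1r ler_piMr ?powR_ge0//.
    by have /andP[] := cut_itv N u.
rewrite F0 opprK gerDr /F mulNr oppr_le0 mulr_ge0 ?powR_ge0// invr_ge0 ltW//.
Qed.

End Cutoffs.

(** * Moments of analytic functions *)

Section Moments.
Context {R : realType}.
Local Notation C := R[i].
Local Notation pm := (@plane_measure R).
Local Notation T2 := (measurableTypeR R * measurableTypeR R)%type.
Local Notation mfun := (@measurable_fun _ _ T2 R plane_disc).
Local Notation D := (@plane_disc R).
Local Notation Re := (@complex.Re R).
Local Notation Im := (@complex.Im R).
Local Notation "x %:C" := (real_complex R x).
Variable alpha : R.
Hypothesis alpha_gt : -1 < alpha.
Implicit Types (f F G : C -> C) (chi : R -> R) (l i : nat).
Local Notation dI := (disc_integral alpha).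

Local Notation Ir := (weighted_integral alpha).

Lemma rint_measurable h : dens_integrable alpha h -> mfun (fun p => h p * dens alpha p).
Proof. by move=> /integrableP[/measurable_EFinP]. Qed.

(** Comparing [cutN N] with [cutN 8] through [bump_mul_integral] for [f = 1] and [l = 0] turns the
    uniform bound on one-dimensional moments into one on area integrals. *)
Lemma Ir_cut_le : exists M, forall N, Ir (cutN N \o plane_sqn) <= M.
Proof.
pose one : C -> C := fun=> 1.
have E chi : bump_mul one 0 chi = fun z => (chi (sqn z))%:C.
  by apply/funext => z; rewrite /bump_mul /one expr0 !mul1r.
have a1 : analytic_on_disc one by move=> z _; exact: derivable_cst.
have ci N : cintegrable alpha (bump_mul one 0 (cutN N)).
  rewrite E; split.
  - apply: (@cmeas_real _ (cutN N \o plane_sqn)) => //.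
    by apply: measurable_radial; apply: continuous_measurable_fun; exact: (cut_bump N).1.
  - exact: (@bump_rint R alpha _ (cut_bump N)).
  - rewrite /dens_integrable (_ : EFin \o _ = fun=> 0%E); first exact: integrable0.
    by apply/funext => p /=; rewrite mul0r.
have k0 := bump_moment_cut8_gt0 alpha 0.
exists ((1 + alpha)^-1 * Ir (cutN 8 \o plane_sqn) / bump_moment alpha 0 (cutN 8)) => N.
rewrite ler_pdivlMr//.
have := bump_mul_integral alpha_gt a1 (cut_bump N) (cut_bump 8) (ci N) (ci 8).
move=> /(congr1 Re); rewrite !E !disc_integralE !cReM/= !mul0r !subr0.
rewrite [X in X = _]mulrC /weighted_integral /= => ->; apply: ler_wpM2r; last exact: bump_moment_cut_le.
apply: Rintegral_ge0 => p _; rewrite mulr_ge0 ?dens_ge0//.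
by have /andP[] := cut_itv 8 (plane_sqn p).
Qed.

Lemma u2_ge0 (p : R * R) : 0 <= plane_sqn p.
Proof. by rewrite addr_ge0// sqr_ge0. Qed.

Lemma u2_eq0 (p : R * R) : plane_sqn p = 0 -> p = (0, 0).
Proof.
case: p => x y /eqP; rewrite /plane_sqn/= paddr_eq0 ?sqr_ge0// !sqrf_eq0.
by move=> /andP[/eqP-> /eqP->].
Qed.

(** Monotone convergence along the cutoffs, whose integrals are bounded by [Ir_cut_le]. *)
Lemma dens_integrable1 : dens_integrable alpha (fun=> 1).
Proof.
pose h N (p : R * R) : \bar R := (cutN N (plane_sqn p) * dens alpha p)%:E.
have mh N : @measurable_fun _ _ T2 _ D (h N).
  by apply/measurable_EFinP; apply: rint_measurable (@bump_rint R alpha _ (cut_bump N)).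
have h0 N p : D p -> (0 <= h N p)%E.
  by move=> _; rewrite lee_fin mulr_ge0 ?dens_ge0//; have /andP[] := cut_itv N (plane_sqn p).
have hm p : D p -> {homo h^~ p : n m / (n <= m)%N >-> (n <= m)%E}.
  move=> /plane_discP/ltW up n m nm; rewrite lee_fin ler_wpM2r ?dens_ge0//.
  by apply: cut_mono => //; rewrite u2_ge0.
have mlim : @measurable_fun _ _ T2 _ D (fun p => limn (h^~ p)).
  apply: (@emeasurable_fun_cvg _ T2 R D h) => // p Dp.
  by apply: ereal_nondecreasing_is_cvgn; exact: hm.
have ilim : pm.-integrable D (fun p => limn (h^~ p)).
  apply/integrableP; split => //.
  have cv := @cvg_monotone_convergence _ T2 R pm D measurable_disc h mh h0 hm.
  have [M HM] := Ir_cut_le.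
  have -> : (\int[pm]_(p in D) `|limn (h^~ p)| = \int[pm]_(p in D) limn (h^~ p))%E.
    apply: eq_integral => p /[!inE] Dp; rewrite gee0_abs//; apply: lime_ge.
      by apply: ereal_nondecreasing_is_cvgn; exact: hm.
    by near=> N; exact: h0.
  rewrite -(cvg_lim _ cv)//; apply: (@le_lt_trans _ _ M%:E); last exact: ltry.
  apply: lime_le; first by apply/cvg_ex; eexists; exact: cv.
  near=> N; have := HM N; rewrite -lee_fin; apply: le_trans.
  by rewrite /weighted_integral /Rintegral fineK//; apply: integrable_fin_num => //; exact: (@bump_rint R alpha _ (cut_bump N)).
(* All cutoffs vanish at the origin, where the density equals [k]; adding the constant [k] to the
   limit gives a majorant at every point. *)
pose k : R := (1 + alpha) / pi.
have ik : pm.-integrable D (EFin \o cst k).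
  by apply: (@bounded_integrable _ _ _ _ _ _ `|k|) => //; [exact: pm_disc_fin].
have := integrableD measurable_disc ilim ik; apply: le_integrable => //.
  apply/measurable_EFinP; apply: measurable_funM; last exact: measurable_densD.
  exact: measurable_cst.
move=> p Dp; rewrite /= mul1r.
have l0 : (0 <= limn (h^~ p))%E.
  apply: lime_ge; first by apply: ereal_nondecreasing_is_cvgn; exact: hm.
  by near=> N; exact: h0.
have k0 : 0 <= k by rewrite divr_ge0 ?pi_ge0// -lerBlDl sub0r ltW.
rewrite (ger0_norm (dens_ge0 alpha_gt p)) gee0_abs ?adde_ge0 ?lee_fin//.
have [/u2_eq0 p0|p0] := eqVneq (plane_sqn p) 0.
  rewrite p0 densE /plane_sqn/= expr0n/= addr0 subr0 powR1 mulr1.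
  by rewrite -p0 leeDr.
rewrite (_ : limn _ = (dens alpha p)%:E) ?leeDl ?lee_fin//.
apply/cvg_lim => //; apply: cvg_EFin; first by near=> N.
rewrite -[X in _ --> X]mul1r; apply: cvgM; last exact: cvg_cst.
by apply: cut_cvg; rewrite lt_neqAle eq_sym p0 u2_ge0/=; apply/plane_discP.
Unshelve. all: by end_near. Qed.

Lemma ae_neq0 : \forall p \ae pm, plane_sqn p != 0.
Proof.
exists ([set 0] `*` [set 0]); split.
- exact: measurableX.
- have E : (pm ([set (0 : R)%R] `*` [set (0 : R)%R]) = 0)%E.
    by rewrite /plane_measure product_measure1E//= lebesgue_measure_set1 mul0e.
  exact: E.
- by move=> p /= /negP; rewrite negbK => /eqP/u2_eq0 ->.
Qed.

(** The cutoffs lie in [[0, 1]] and tend to 1 on the disc except at the origin, a null set; [|h|]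
    times the density dominates. *)
Lemma Ir_cut_cvg h : mfun h -> dens_integrable alpha h ->
  Ir (fun p => h p * cutN N (plane_sqn p)) @[N --> \oo] --> Ir h.
Proof.
move=> mh ih; rewrite /weighted_integral.
have mc N : mfun (cutN N \o plane_sqn).
  by apply: measurable_radial; apply: continuous_measurable_fun; exact: (cut_bump N).1.
have [|||||i1 _ cv] := @dominated_convergence _ T2 R pm D measurable_disc
  (fun N p => (h p * cutN N (plane_sqn p) * dens alpha p)%:E)
  (fun p => (h p * dens alpha p)%:E) (fun p => `|(h p * dens alpha p)%:E|)%E.
- move=> N; apply/measurable_EFinP; apply: measurable_funM; last exact: measurable_densD.
  by apply: measurable_funM => //; exact: mc.
- by apply/measurable_EFinP; exact: rint_measurable.
- have [A [mA A0 sub]] := ae_neq0; exists A; split => // p /= np; apply: sub => /= p0; apply: np => /plane_discP up.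
  apply: cvg_EFin; first by near=> N.
  apply: cvgM; last exact: cvg_cst.
  rewrite -[X in _ --> X]mulr1; apply: cvgM; first exact: cvg_cst.
  by apply: cut_cvg; rewrite lt_neqAle eq_sym p0 u2_ge0.
- exact: integrable_abse.
- apply: aeW => p N _; rewrite lee_fin mulrAC normrM ler_piMr//.
  by have /andP[c0 c1] := cut_itv N (plane_sqn p); rewrite ger0_norm.
by apply: fine_cvg; rewrite fineK//; apply: integrable_fin_num.
Unshelve. all: by end_near. Qed.

Lemma Ir_gt0 h : mfun h -> dens_integrable alpha h -> (forall p, D p -> 0 <= h p) ->
  (forall p, 1 / 4 <= plane_sqn p <= 3 / 4 -> 0 < h p) -> 0 < Ir h.
Proof.
move=> mh ih h0 hp.
(* On this rectangle [|z|^2] lies between [9/25] and [49/100 + 1/100], inside the plateau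
   [[1/4, 3/4]]. *)
pose E : set T2 := rect (3 / 5) (7 / 10) 0 (1 / 10).
have EI p : E p -> 1 / 4 <= plane_sqn p <= 3 / 4.
  rewrite /E /rect/= !in_itv/= /plane_sqn => -[/andP[x0 x1] /andP[y0 y1]].
  by apply/andP; split; nra.
apply: (@Rintegral_gt0 _ _ T2 pm _ E) => //.
- exact: measurable_rect.
- by move=> p Dp; rewrite mulr_ge0 ?dens_ge0//; exact: h0.
- by move=> p /EI/andP[_ h1]; apply/plane_discP; lra.
- move=> p Ep; rewrite mulr_gt0 ?hp ?EI//; apply: dens_gt0 => //.
  by apply/plane_discP; have /andP[] := EI p Ep; lra.
- have e0 : (0 < pm E)%E by rewrite pm_rect ?lte_fin; lra.
  exact: e0.
Qed.

Lemma Re_real (x : R) (z : C) : Re (z * x%:C) = Re z * x.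
Proof. by rewrite cReM/= mulr0 subr0. Qed.

Lemma Im_real (x : R) (z : C) : Im (z * x%:C) = Im z * x.
Proof. by rewrite cImM/= mulr0 add0r. Qed.

Lemma cmeas_radial (h : R -> R) : continuous h -> cmeasurable (fun z => (h (sqn z))%:C).
Proof.
move=> ch; apply: (@cmeas_real _ (h \o plane_sqn)) => //.
by apply: measurable_radial; exact: continuous_measurable_fun.
Qed.

Lemma cint_radial (h : R -> R) : continuous h -> (forall u, 0 <= u <= 1 -> 0 <= h u <= 1) ->
  cintegrable alpha (fun z => (h (sqn z))%:C).
Proof.
move=> ch h1.
have c1 : cintegrable alpha (fun=> 1).
  split; [exact: cmeas_cst|exact: dens_integrable1|].
  rewrite /dens_integrable (_ : EFin \o _ = fun=> 0%E); first exact: integrable0.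
  by apply/funext => p /=; rewrite mul0r.
have := @cintM_bounded _ alpha _ _ 1 c1 (cmeas_radial ch).
rewrite (_ : (fun z => 1 * _) = fun z => (h (sqn z))%:C); last by apply/funext => z; rewrite mul1r.
apply=> z; rewrite unit_discE => /ltW uz; rewrite /= normr0.
have /andP[a b] := h1 (sqn z) (introT andP (conj (sqn_ge0 z) uz)).
by rewrite ger0_norm.
Qed.

Lemma cintM_radial G (h : R -> R) : cintegrable alpha G -> continuous h ->
  (forall u, 0 <= u <= 1 -> 0 <= h u <= 1) -> cintegrable alpha (fun z => G z * (h (sqn z))%:C).
Proof.
move=> cG ch h1; apply: (@cintM_bounded _ alpha _ _ 1 cG (cmeas_radial ch)).
move=> z; rewrite unit_discE => /ltW uz; rewrite /= normr0.
have /andP[a b] := h1 (sqn z) (introT andP (conj (sqn_ge0 z) uz)).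
by rewrite ger0_norm.
Qed.

Lemma expn_cut_itv i N (u : R) : 0 <= u <= 1 -> 0 <= u ^+ i * cutN N u <= 1.
Proof.
move=> /andP[u0 u1]; have /andP[c0 c1] := cut_itv N u.
by rewrite mulr_ge0 ?exprn_ge0//= mulr_ile1 ?exprn_ge0 ?exprn_ile1.
Qed.

(* The one-dimensional moments of [bump_mul_integral] are eliminated between [f] and [z^l];
   then the cutoffs are removed by dominated convergence. *)
Lemma moment_real f l i (T : C -> R) : analytic_on_disc f ->
  cintegrable alpha (fun z => f z * conjc z ^+ l) ->
  (T = Re \/ T = Im) ->
  Ir (fun p => T (f (of_plane p) * conjc (of_plane p) ^+ l) * plane_sqn p ^+ i) * Ir (fun p => plane_sqn p ^+ l)
  = Ir (fun p => plane_sqn p ^+ (l + i)) * Ir (fun p => T (f (of_plane p) * conjc (of_plane p) ^+ l)).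
Proof.
move=> af cf HT; pose t p := T (f (of_plane p) * conjc (of_plane p) ^+ l).
have TZ (x : R) z : T (z * x%:C) = T z * x by case: HT => ->; [exact: Re_real|exact: Im_real].
have TdI F : T (dI F) = Ir (fun p => T (F (of_plane p))).
  by rewrite disc_integralE; case: HT => ->.
have TcI F : cintegrable alpha F -> mfun (fun p => T (F (of_plane p))) /\ dens_integrable alpha (fun p => T (F (of_plane p))).
  by move=> [[? ?] ? ?]; case: HT => ->.
pose m0 := Ir (fun p => plane_sqn p ^+ l * cutN 8 (plane_sqn p)); pose Y0 := Ir (fun p => t p * cutN 8 (plane_sqn p)).
have bX j N : is_bump (fun u : R => u ^+ j * cutN N u) := bumpX j (cut_bump N).
pose fl : C -> C := fun z => z ^+ l.
have afl : analytic_on_disc fl.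
  move=> z _; exact: (@exprn_derivable C l z 1).
have GE chi : bump_mul fl l chi = fun z => (sqn z ^+ l * chi (sqn z))%:C.
  by apply/funext => z; rewrite /bump_mul /fl -exprMn mul_conjc -rmorphXn -rmorphM.
have cX j : continuous (fun u : R => u ^+ j) by exact: exprn_continuous.
have cG j N : cintegrable alpha (bump_mul f l (fun u => u ^+ j * cutN N u)).
  apply: (@cintM_radial _ (fun u => u ^+ j * cutN N u) cf); first exact: (bX j N).1.
  exact: expn_cut_itv.
have cGl j N : cintegrable alpha (bump_mul fl l (fun u => u ^+ j * cutN N u)).
  rewrite GE (_ : (fun z => _) = fun z => ((fun u => u ^+ (l + j) * cutN N u) (sqn z))%:C).
    exact: (@cint_radial (fun u : R => u ^+ (l + j) * cutN N u) (bX _ N).1 (@expn_cut_itv (l + j) N)).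
  by apply/funext => z; rewrite exprD mulrA.
have cut8X : (fun u : R => u ^+ 0 * cutN 8 u) = cutN 8 by apply/funext => u; rewrite expr0 mul1r.
(* The relation for [f] and the one for [z^l] contain the same moment of [u^j cutN N]; eliminating
   it leaves only area integrals. *)
have step j N : Ir (fun p => t p * plane_sqn p ^+ j * cutN N (plane_sqn p)) * m0 =
    Ir (fun p => plane_sqn p ^+ (l + j) * cutN N (plane_sqn p)) * Y0.
  have k0 : bump_moment alpha l (cutN 8) != 0 by rewrite gt_eqF// bump_moment_cut8_gt0.
  have := bump_mul_integral alpha_gt af (bX j N) (bX 0%N 8) (cG j N) (cG 0%N 8).
  rewrite cut8X !(mulrC (_%:C)) => /(congr1 T); rewrite !TZ !TdI.
  have := bump_mul_integral alpha_gt afl (bX j N) (bX 0%N 8) (cGl j N) (cGl 0%N 8).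
  rewrite cut8X !(mulrC (_%:C)) => /(congr1 Re); rewrite !Re_real !disc_integralE/= !GE/=.
  rewrite -![\int[_]_(_ in _) _]/(Ir _).
  have -> : Ir (fun p => T (bump_mul f l (fun u => u ^+ j * cutN N u) (of_plane p))) =
            Ir (fun p => t p * plane_sqn p ^+ j * cutN N (plane_sqn p)).
    by congr weighted_integral; apply/funext => p; rewrite /bump_mul TZ mulrA.
  have -> : Ir (fun p => T (bump_mul f l (cutN 8) (of_plane p))) = Y0.
    by congr weighted_integral; apply/funext => p; rewrite /bump_mul TZ.
  have -> : Ir (fun p => sqn (of_plane p) ^+ l * (sqn (of_plane p) ^+ j * cutN N (sqn (of_plane p)))) =
            Ir (fun p => plane_sqn p ^+ (l + j) * cutN N (plane_sqn p)).
    by congr weighted_integral; apply/funext => p; rewrite exprD mulrA.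
  rewrite -[Ir (fun p => sqn (of_plane p) ^+ l * _)]/m0.
  move=> e1 e2; apply: (mulIf k0); rewrite mulrAC e2 [RHS]mulrAC e1; ring.
have lim j : Ir (fun p => t p * plane_sqn p ^+ j) * m0 = Ir (fun p => plane_sqn p ^+ (l + j)) * Y0.
  have uj (u : R) : 0 <= u <= 1 -> 0 <= u ^+ j <= 1.
    by move=> /andP[? ?]; rewrite exprn_ge0//= exprn_ile1.
  have ulj (u : R) : 0 <= u <= 1 -> 0 <= u ^+ (l + j) <= 1.
    by move=> /andP[? ?]; rewrite exprn_ge0//= exprn_ile1.
  have [m1 i1] := TcI _ (cintM_radial cf (cX j) uj).
  have [[m2 _] i2 _] := cint_radial (cX (l + j)%N) ulj.
  have tE : (fun p => T (f (of_plane p) * conjc (of_plane p) ^+ l * (sqn (of_plane p) ^+ j)%:C)) =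
      fun p => t p * plane_sqn p ^+ j by apply/funext => p; rewrite TZ.
  rewrite tE in m1 i1.
  have e1 := Ir_cut_cvg m1 i1; have c2 := Ir_cut_cvg m2 i2.
  have h1 : (fun N => Ir (fun p => t p * plane_sqn p ^+ j * cutN N (plane_sqn p)) * m0) N @[N --> \oo]
      --> Ir (fun p => t p * plane_sqn p ^+ j) * m0 by apply: cvgM; [exact: e1|exact: cvg_cst].
  have h2 : (fun N => Ir (fun p => plane_sqn p ^+ (l + j) * cutN N (plane_sqn p)) * Y0) N @[N --> \oo]
      --> Ir (fun p => plane_sqn p ^+ (l + j)) * Y0 by apply: cvgM; [exact: c2|exact: cvg_cst].
  rewrite -(funext (step j)) in h2.
  exact: (cvg_unique (@Rhausdorff R) h1 h2).
have m0_gt : 0 < m0.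
  have [[mm _] ii _] := cGl 0%N 8.
  apply: Ir_gt0.
  - by move: mm; rewrite cut8X GE.
  - by move: ii; rewrite cut8X GE.
  - by move=> p _; rewrite mulr_ge0 ?exprn_ge0 ?u2_ge0//; have /andP[] := cut_itv 8 (plane_sqn p).
  - move=> p up; rewrite cut8// mulr1 exprn_gt0//; have /andP[] := up; lra.
(* The cases [j = 0] and [j = i] share the unknown [Y0], which is eliminated; then [m0] cancels. *)
have l0 := lim 0%N; have li := lim i.
have t0 : (fun p => t p * plane_sqn p ^+ 0) = t by apply/funext => p; rewrite expr0 mulr1.
rewrite t0 addn0 in l0.
have mn0 : m0 != 0 by rewrite gt_eqF.
apply: (mulIf mn0); rewrite mulrAC li -[RHS]mulrA -[Ir (fun p => T _)]/(Ir t) l0; ring.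
Unshelve. all: by end_near. Qed.

End Moments.

(** * Bergman projection *)

Section Projection.
Context {R : realType}.
Local Notation C := R[i].
Local Notation pm := (@plane_measure R).
Local Notation T2 := (measurableTypeR R * measurableTypeR R)%type.
Local Notation D := (@plane_disc R).
Local Notation Re := (@complex.Re R).
Local Notation Im := (@complex.Im R).
Local Notation "x %:C" := (real_complex R x).
Variable alpha : R.
Hypothesis alpha_gt : -1 < alpha.
Implicit Types (f F G : C -> C) (chi : R -> R) (l i m : nat) (z : C) (c : C) (g h : C -> C).
Local Notation dI := (disc_integral alpha).

Local Notation Ir := (weighted_integral alpha).
Local Notation bg := (bergman alpha).

(** The quotient of the squared norms of [z^(l+i)] and [z^l]. Later only its being real and positive
    matters, so it is not evaluated through Gamma. *)
Definition moment_ratio l i : R := Ir (fun p => plane_sqn p ^+ (l + i)) / Ir (fun p => plane_sqn p ^+ l).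

Lemma Ir_u2X_gt0 m : 0 < Ir (fun p => plane_sqn p ^+ m).
Proof.
have [|[mh _] ih _] := @cint_radial _ _ alpha_gt (fun u => u ^+ m) (@exprn_continuous _ m).
  by move=> u /andP[? ?]; rewrite exprn_ge0//= exprn_ile1.
apply: Ir_gt0 => //.
- by move=> p _; rewrite exprn_ge0// u2_ge0.
- by move=> p /andP[? ?]; rewrite exprn_gt0//; lra.
Qed.

Lemma mratio_gt0 l i : 0 < moment_ratio l i.
Proof. by rewrite divr_gt0// Ir_u2X_gt0. Qed.

Lemma moment f l i : analytic_on_disc f -> cintegrable alpha (fun z => f z * conjc z ^+ l) ->
  dI (fun z => f z * conjc z ^+ l * ((sqn z) ^+ i)%:C) =
  (moment_ratio l i)%:C * dI (fun z => f z * conjc z ^+ l).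
Proof.
move=> af cf.
have H (T : C -> R) (HT : T = Re \/ T = Im) : Ir (fun p => T (f (of_plane p) * conjc (of_plane p) ^+ l) * plane_sqn p ^+ i) =
    moment_ratio l i * Ir (fun p => T (f (of_plane p) * conjc (of_plane p) ^+ l)).
  have l0 : Ir (fun p => plane_sqn p ^+ l) != 0 by rewrite gt_eqF// Ir_u2X_gt0.
  apply: (mulIf l0); rewrite (moment_real alpha_gt i af cf HT) /moment_ratio mulrAC.
  by rewrite divfK.
rewrite !disc_integralE; apply/eqP; rewrite eq_complex/= !mul0r subr0 addr0.
apply/andP; split; apply/eqP.
  rewrite -[RHS](H Re (or_introl erefl)); apply: eq_Rintegral => p _.
  by rewrite Re_real.
rewrite -[RHS](H Im (or_intror erefl)); apply: eq_Rintegral => p _.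
by rewrite Im_real.
Qed.

Lemma L2_1 : L2 alpha (fun=> 1).
Proof.
apply: (L2_of_rint alpha_gt (cmeas_cst _)).
move: (dens_integrable1 alpha_gt); congr dens_integrable; apply/funext => p.
by rewrite /sqn/= expr1n expr0n addr0.
Qed.

Lemma sqnX z m : sqn (z ^+ m) = sqn z ^+ m.
Proof. by elim: m => [|m IH]; [rewrite !expr0 /sqn/= expr1n expr0n addr0|rewrite !exprS sqnM IH]. Qed.

Lemma sqnJ z : sqn (conjc z) = sqn z.
Proof. by rewrite /sqn cReJ cImJ sqrrN. Qed.

Lemma sqnX_le1 z m : unit_disc z -> sqn (z ^+ m) <= 1.
Proof. by rewrite unit_discE sqnX => /ltW h; rewrite exprn_ile1 ?sqn_ge0. Qed.

Lemma L2_mulX f m : L2 alpha f -> L2 alpha (fun z => z ^+ m * f z).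
Proof.
move=> Lf; apply: L2M_bounded => //; first by apply: cmeasX; exact: cmeas_id.
by move=> z; exact: sqnX_le1.
Qed.

Lemma L2_mulJX f m : L2 alpha f -> L2 alpha (fun z => conjc z ^+ m * f z).
Proof.
move=> Lf; apply: L2M_bounded => //.
  by apply: cmeasX; apply: cmeasJ; exact: cmeas_id.
by move=> z uz; rewrite sqnX sqnJ -sqnX; exact: sqnX_le1.
Qed.

Lemma L2_eq f g : (forall z, unit_disc z -> f z = g z) -> L2 alpha f -> L2 alpha g.
Proof.
move=> fg Lf; have [[m1 m2] _] := iffLR (L2P alpha_gt _) Lf.
apply: (L2_le alpha_gt _ Lf); last by move=> z /fg ->.
split.
  by apply: eq_measurable_fun m1 => p; rewrite inE => Dp; rewrite fg.
by apply: eq_measurable_fun m2 => p; rewrite inE => Dp; rewrite fg.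
Qed.

Lemma near_disc z : unit_disc z -> \forall z' \near (z : C^o), unit_disc z'.
Proof.
rewrite unit_discE => uz; have e0 : 0 < (1 - sqn z) / 2 by rewrite divr_gt0// subr_gt0.
apply/near_boxP; have [d d0 H] := iffLR (ct_box _ _) (ct_sqn z) _ e0.
exists d => // z' hx hy; have [/= + _] := H z' hx hy.
by rewrite unit_discE ler_norml => /andP[_ h]; move: uz h; lra.
Qed.

Lemma analytic_eq f g : (forall z, unit_disc z -> f z = g z) -> analytic_on_disc f ->
  analytic_on_disc g.
Proof.
move=> fg af z uz; apply: (@near_eq_derivable C C^o C^o f); last exact: af.
by apply: filterS (near_disc uz) => z' /fg.
Qed.

Definition disc_poly (p : {poly C}) : C -> C := fun z => if `|z| < 1 then p.[z] else 0.

Lemma polE (p : {poly C}) z : unit_disc z -> disc_poly p z = p.[z].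
Proof. by rewrite /disc_poly /unit_disc/= => ->. Qed.

Lemma bergman_comb (c : C) f g : bg f -> bg g -> bg (fun z => c * f z + g z).
Proof.
move=> [f0 af Lf] [g0 ag Lg]; split.
- by move=> z nz; rewrite f0// g0// mulr0 addr0.
- move=> z uz; apply: (@derivableD C C^o C^o (fun z => c * f z) g); last exact: ag.
  by apply: (@derivableZ C C^o C^o f c); exact: af.
- by apply: L2D => //; apply: L2Z.
Qed.

Lemma bergman0 : bg (fun=> 0).
Proof. by split; [by []|move=> z _; exact: derivable_cst|exact: (L2_0 alpha_gt)]. Qed.

Lemma bergmanZ (c : C) f : bg f -> bg (fun z => c * f z).
Proof. by move=> bf; have := bergman_comb c bf bergman0; under eq_fun do rewrite addr0. Qed.

Lemma bergmanD f g : bg f -> bg g -> bg (fun z => f z + g z).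
Proof. by move=> bf bg'; have := bergman_comb 1 bf bg'; under eq_fun do rewrite mul1r. Qed.

Lemma polD (p q : {poly C}) : disc_poly (p + q) = fun z => disc_poly p z + disc_poly q z.
Proof. by apply/funext => z; rewrite /disc_poly; case: ifP => _; rewrite ?hornerD ?addr0. Qed.

Lemma polZ c (p : {poly C}) : disc_poly (c *: p) = fun z => c * disc_poly p z.
Proof. by apply/funext => z; rewrite /disc_poly; case: ifP => _; rewrite ?hornerZ ?mulr0. Qed.

Lemma pol0 : disc_poly 0 = fun=> 0.
Proof. by apply/funext => z; rewrite /disc_poly horner0 if_same. Qed.

Lemma bergman_polX m : bg (disc_poly 'X^m).
Proof.
split.
- by move=> z; rewrite /unit_disc/= /disc_poly; case: ifP.
- apply: (@analytic_eq (fun z => z ^+ m)) => [z uz|z _]; first by rewrite polE// hornerXn.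
  exact: (@exprn_derivable C m z 1).
- apply: (@L2_eq (fun z => z ^+ m * 1)) => [z uz|]; first by rewrite polE// hornerXn mulr1.
  by apply: L2_mulX; exact: L2_1.
Qed.

Lemma bergman_pol (p : {poly C}) : bg (disc_poly p).
Proof.
rewrite -[p]coefK poly_def; elim/big_ind: _ => [|q r bq br|i _].
- by rewrite pol0; exact: bergman0.
- by rewrite polD; exact: bergmanD.
- by rewrite polZ; apply: bergmanZ; exact: bergman_polX.
Qed.

(** A nonzero difference would have more roots than its degree allows, among the points
    [1 / (j + 2)] of the disc. This is how identities between operators become identities between
    coefficients. *)
Lemma pol_inj : injective disc_poly.
Proof.
move=> p q pq; apply/eqP; rewrite -subr_eq0; apply/negPn/negP => r0.
set r := p - q in r0.
pose pt (j : nat) : C := (j.+2%:R^-1)%:C.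
have pt_disc j : unit_disc (pt j).
  rewrite unit_discE /sqn/= expr0n addr0 expr_lte1 ?invr_ge0//.
  by rewrite invf_lt1// ltr1n.
have pt_inj : injective pt.
  move=> i j /(congr1 Re)/= /invr_inj /eqP; rewrite eqr_nat => /eqP [] //.
have rts : all (root r) [seq pt j | j <- iota 0 (size r)].
  apply/allP => z /mapP[j _ ->]; rewrite rootE /r hornerD hornerN.
  have := congr1 (fun f => f (pt j)) pq; rewrite /= !polE// => ->.
  by rewrite subrr.
have uni : uniq [seq pt j | j <- iota 0 (size r)] by rewrite map_inj_uniq ?iota_uniq.
by have := max_poly_roots r0 rts uni; rewrite size_map size_iota ltnn.
Qed.

(** If [h z] is nonzero, [|h|^2] stays positive on a small square at [z] by continuity, which
    contradicts the vanishing of its integral. *)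
Lemma inner_self0 h : bg h -> inner alpha h h = 0 -> h = fun=> 0.
Proof.
move=> [h0 ah Lh] /(congr1 Re); rewrite /inner disc_integralE/=.
have [[m1 m2] ih] := iffLR (L2P alpha_gt _) Lh.
under eq_Rintegral do rewrite mul_conjc/=.
move=> I0; apply/funext => z.
have [uz|nuz] := pselect (unit_disc z); last exact: h0.
apply: sqn_eq0; apply/eqP; apply/negPn/negP => hz.
have {}hz : 0 < sqn (h z) by rewrite lt_neqAle eq_sym hz sqn_ge0.
have cth : ctn_at h z by have [A /cara_ct] := cara_derivable (ah z uz).
have cs : ctn_at (fun z => (sqn (h z))%:C) z.
  rewrite (_ : (fun z => _) = fun z => h z * conjc (h z)); last by apply/funext => ?; rewrite mul_conjc.
  apply: ctM => //; apply/ct_box => e e0; have [d d0 H] := iffLR (ct_box _ _) cth _ e0.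
  exists d => // z' hx hy; have [h1 h2] := H z' hx hy.
  by rewrite !cReJ !cImJ; split => //; rewrite -opprD normrN.
have [d1 d10 H1] := iffLR (near_boxP _ _) (near_disc uz).
have [d2 d20 H2] := iffLR (ct_box _ _) cs _ (divr_gt0 hz (ltr0Sn _ 1)).
pose d := Num.min d1 d2.
have d0 : 0 < d by rewrite lt_min d10.
pose E := rect (Re z) (Re z + d) (Im z) (Im z + d).
have EI p : E p -> unit_disc (of_plane p) /\ 0 < sqn (h (of_plane p)).
  rewrite /E /rect/= !in_itv/= => -[/andP[x0 x1] /andP[y0 y1]].
  have hx : `|p.1 - Re z| <= d by rewrite ler_norml; apply/andP; split; lra.
  have hy : `|p.2 - Im z| <= d by rewrite ler_norml; apply/andP; split; lra.
  move: (hx) (hy); rewrite !le_min => /andP[hx1 hx2] /andP[hy1 hy2].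
  split; first exact: H1.
  have [/= + _] := H2 (of_plane p) hx2 hy2.
  by rewrite ler_norml => /andP[+ _]; move: hz; lra.
have := @Rintegral_gt0 _ _ T2 pm D E (fun p => sqn (h (of_plane p)) * dens alpha p).
rewrite I0 ltxx => H; suff : false by []; apply: H => //.
- exact: measurable_rect.
- by move=> p _; rewrite mulr_ge0 ?sqn_ge0 ?dens_ge0.
- by move=> p /EI[].
- by move=> p /EI[uz' ?]; rewrite mulr_gt0// dens_gt0.
- have e0 : (0 < pm E)%E.
    by rewrite pm_rect ?lerDl ?ltW// lte_fin !(addrC _ d) !addrK mulr_gt0.
  exact: e0.
Qed.

(** A witnessed form of [bergman_proj]: unlike the choice, it is additive by construction. Including
    [L2 alpha g] lets inner products be split. *)
Definition is_proj (g h : C -> C) := [/\ L2 alpha g, bg h &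
  forall f, bg f -> inner alpha (fun z => g z - h z) f = 0].

Lemma L2B f g : L2 alpha f -> L2 alpha g -> L2 alpha (fun z => f z - g z).
Proof.
move=> Lf Lg; rewrite (_ : (fun z => _) = fun z => f z + (-1) * g z).
  by apply: L2D => //; exact: L2Z.
by apply/funext => z; rewrite mulN1r.
Qed.

(** The difference [h' - h = (g - h) - (g - h')] is orthogonal to the Bergman space and belongs to
    it, hence orthogonal to itself. *)
Lemma isproj_unique g h h' : is_proj g h -> is_proj g h' -> h = h'.
Proof.
move=> [Lg bh H] [_ bh' H'].
have Lh : L2 alpha h by case: bh. have Lh' : L2 alpha h' by case: bh'.
have bd : bg (fun z => h' z - h z).
  by have := bergman_comb (-1) bh bh'; congr bg; apply/funext => z; rewrite mulN1r addrC.
have Ld : L2 alpha (fun z => h' z - h z) by case: bd.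
have Lgh : L2 alpha (fun z => g z - h z) by exact: L2B.
have Lgh' : L2 alpha (fun z => g z - h' z) by exact: L2B.
suff E : (fun z => h' z - h z) = fun=> 0.
  by apply/funext => z; apply/eqP; rewrite eq_sym -subr_eq0; apply/eqP; exact: (congr1 (@^~ z) E).
apply: inner_self0 => //; set d := (X in inner _ _ X).
rewrite (_ : (fun z => h' z - h z) = fun z => (g z - h z) + (-1) * (g z - h' z)).
  rewrite innerDl//; last by apply: L2Z.
  by rewrite innerZl// H// H'// mulr0 addr0.
by apply/funext => x; ring.
Qed.

Lemma isprojE g h : is_proj g h -> bergman_proj alpha g = h.
Proof.
move=> gh; have [Lg bh H] := gh; apply: xget_unique => // h' [bh' H'].
by apply: isproj_unique (gh); split.
Qed.

Lemma bergman_proj_bg g : bg (bergman_proj alpha g).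
Proof.
rewrite /bergman_proj; case: xgetP => [h _ []//|_]; exact: bergman0.
Qed.

Lemma isprojZ c g h : is_proj g h -> is_proj (fun z => c * g z) (fun z => c * h z).
Proof.
move=> [Lg bh H]; have Lh : L2 alpha h by case: bh.
split; [exact: L2Z|exact: bergmanZ|move=> f bf].
have Lf : L2 alpha f by case: bf.
rewrite (_ : (fun z => _) = fun z => c * (g z - h z)); last by apply/funext => z; rewrite mulrBr.
by rewrite innerZl//; [rewrite H// mulr0|exact: L2B].
Qed.

Lemma isprojD g h g' h' : is_proj g h -> is_proj g' h' ->
  is_proj (fun z => g z + g' z) (fun z => h z + h' z).
Proof.
move=> [Lg bh H] [Lg' bh' H']; have Lh : L2 alpha h by case: bh.
have Lh' : L2 alpha h' by case: bh'.
split; [exact: L2D|exact: bergmanD|move=> f bf].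
have Lf : L2 alpha f by case: bf.
rewrite (_ : (fun z => _) = fun z => (g z - h z) + (g' z - h' z)); last by apply/funext => z; ring.
by rewrite innerDl//; [rewrite H// H'// addr0|exact: L2B|exact: L2B].
Qed.

Lemma isproj0 : is_proj (fun=> 0) (fun=> 0).
Proof.
split; [exact: L2_0|exact: bergman0|move=> f [_ _ Lf]].
have := innerZl alpha_gt 0 (L2_0 alpha_gt) Lf; under eq_fun do rewrite mul0r.
by rewrite mul0r => H; under eq_fun do rewrite subrr.
Qed.

Lemma isproj_id h : bg h -> is_proj h h.
Proof.
move=> bh; split => //; first by case: bh.
move=> f bf; have [_ _ H] := isproj0.
rewrite (_ : (fun z => h z - h z) = fun=> 0 - 0); first exact: H.
by apply/funext => z; rewrite !subrr.
Qed.

(* Uniqueness alone gives homogeneity: if the projection of [g] does not exist,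
   then neither does that of [c * g], and both sides are the default value [0]. *)
Lemma bergman_projZ c g : L2 alpha g ->
  bergman_proj alpha (fun z => c * g z) = fun z => c * bergman_proj alpha g z.
Proof.
move=> Lg; have [->|c0] := eqVneq c 0.
  rewrite (_ : (fun z => 0 * g z) = fun=> 0); last by apply/funext => z; rewrite mul0r.
  by rewrite (isprojE isproj0); apply/funext => z; rewrite mul0r.
have [[h gh]|nh] := pselect (exists h, is_proj g h).
  by rewrite (isprojE gh) (isprojE (isprojZ c gh)).
have none g' : L2 alpha g' -> ~ (exists h, is_proj g' h) -> bergman_proj alpha g' = fun=> 0.
  move=> Lg' n; rewrite /bergman_proj; case: xgetP => // h _ [bh H].
  by exfalso; apply: n; exists h.
rewrite !none//; last 2 first.
- exact: L2Z.
- move=> [h /(isprojZ c^-1) H]; apply: nh; eexists; move: H; congr is_proj.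
  by apply/funext => z; rewrite mulKf.
by apply/funext => z; rewrite mulr0.
Qed.

Lemma isproj_mulX i m : is_proj (fun z => z ^+ i * disc_poly 'X^m z) (disc_poly 'X^(i + m)).
Proof.
rewrite (_ : (fun z => _) = disc_poly 'X^(i + m)); first by apply: isproj_id; exact: bergman_pol.
apply/funext => z; rewrite /disc_poly; case: ifP => _; last by rewrite mulr0.
by rewrite !hornerXn exprD.
Qed.

(** The conjugate of the inner product of [zbar^i z^(l+i) - r z^l] with [f] is the integral of
    [f zbar^l |z|^(2i) - r f zbar^l], which [moment] makes zero for [r = moment_ratio l i]. *)
Lemma isproj_mulJX i l : is_proj (fun z => conjc z ^+ i * disc_poly 'X^(l + i) z)
  (disc_poly ((moment_ratio l i)%:C *: 'X^l)).
Proof.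
have Lp m : L2 alpha (disc_poly 'X^m) by case: (bergman_pol 'X^m).
split; [exact: L2_mulJX|exact: bergman_pol|move=> f bf].
have [_ af Lf] := bf.
have cf : cintegrable alpha (fun z => f z * conjc z ^+ l).
  have : cintegrable alpha (fun z => f z * conjc (z ^+ l * 1)).
    by apply: (L2_cint alpha_gt Lf); apply: L2_mulX; exact: L2_1.
  by congr cintegrable; apply/funext => z; rewrite mulr1 rmorphXn.
have cfi : cintegrable alpha (fun z => f z * conjc z ^+ l * (sqn z ^+ i)%:C).
  apply: (@cintM_radial _ _ _ (fun u => u ^+ i) cf); first exact: exprn_continuous.
  by move=> u /andP[? ?]; rewrite exprn_ge0//= exprn_ile1.
pose G z := f z * conjc z ^+ l * (sqn z ^+ i)%:C + (- (moment_ratio l i)%:C) * (f z * conjc z ^+ l).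
have cG : cintegrable alpha G by apply: cintD => //; exact: cintZ.
have G0 : dI G = 0.
  by rewrite disc_integralD//; [rewrite disc_integralZ// (moment i af cf) mulNr subrr|exact: cintZ].
rewrite /inner -[RHS](conjc0 R) -G0 -disc_integralJ//.
apply: eq_disc_integral => z uz; rewrite !polE// hornerZ !hornerXn /G.
have -> : (sqn z ^+ i)%:C = (z * conjc z) ^+ i by rewrite mul_conjc rmorphXn.
have rJ : conjc (moment_ratio l i)%:C = (moment_ratio l i)%:C by exact: conjc_real.
move: ((moment_ratio l i)%:C) rJ => r rJ.
rewrite !(rmorphD, rmorphM, rmorphN, rmorphXn)/= rJ !conjcK exprD exprMn; ring.
Qed.

End Projection.

(** * Positivity of the Gamma function *)

Section GammaPos.
Context {R : realType}.
Local Notation C := R[i].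
Local Notation lam := (@lebesgue_measure R).
Variable alpha : R.
Hypothesis alpha_gt : -1 < alpha.
Implicit Types (f F G : C -> C) (chi : R -> R) (l i : nat).

(** With [k = 2 (c + 1)], raise [t / k <= exp (t / k)] to the power [c] and use [c / k <= 1 / 2]. *)
Lemma powR_expR_le (c t : R) : 0 <= c -> 0 < t ->
  t `^ c * expR (- t) <= (2 * (c + 1)) `^ c * expR (- (1 / 2) * t).
Proof.
move=> c0 t0; pose k := 2 * (c + 1).
have k0 : 0 < k by rewrite mulr_gt0// ltr_wpDl.
have tk : t / k <= expR (t / k) by rewrite (le_trans _ (expR_ge1Dx _))// lerDr.
have -> : expR (- (1 / 2) * t) = expR (t / 2) * expR (- t).
  by rewrite -expRD; congr expR; field.
rewrite mulrA ler_wpM2r ?expR_ge0//.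
have {1}-> : t = k * (t / k) by rewrite mulrCA divff ?mulr1// gt_eqF.
have tk0 : 0 <= t / k by rewrite divr_ge0 ?ltW.
rewrite powRM ?(ltW k0)// ler_wpM2l ?powR_ge0//.
apply: (@le_trans _ _ (expR (t / k) `^ c)).
  by rewrite ge0_ler_powR// nnegrE expR_ge0.
rewrite -expRM ler_expR (_ : t / 2 = t / k * (c + 1)).
  by rewrite ler_wpM2l// lerDl.
by rewrite /k; field; rewrite gt_eqF// ltr_wpDl.
Qed.

(** Integrability is essential: the real-valued integral of a nonnegative function with infinite
    integral would be 0. An exponential density of rate [1 / 2] dominates. *)
Lemma Gamma_gt0 (x : R) : 1 <= x -> 0 < Gamma x.
Proof.
move=> x1; have c0 : 0 <= x - 1 by rewrite subr_ge0.
have mG : measurable_fun setT (fun t : R => t `^ (x - 1) * expR (- t)).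
  apply: measurable_funM; first exact: measurable_powR.
  by apply: (measurableT_comp (@measurable_expR R)); exact: measurable_funN.
rewrite /Gamma; apply: (@Rintegral_gt0 _ _ (measurableTypeR R) lam _ `[1, 2]%classic) => //.
(* The leading factor 2 cancels the rate [1 / 2] in front of the density. *)
- pose K : R := 2 * (2 * (x - 1 + 1)) `^ (x - 1).
  have r0 : 0 < 1 / 2 :> R by [].
  have i0 := integrable_exponential_pdf r0.
  have i1 : lam.-integrable `]0, +oo[ (EFin \o exponential_pdf (1 / 2 : R)).
    exact: integrableS i0.
  have mI : measurable (`]0, +oo[%classic : set (measurableTypeR R)) by exact: measurable_itv.
  have := integrableZl mI K i1; apply: le_integrable => //.
    by apply/measurable_EFinP; apply: measurable_funS mG.
  move=> t; rewrite /= in_itv/= andbT => t0.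
  rewrite lee_fin exponential_pdfE; last exact: ltW.
  rewrite !ger0_norm; last 2 first.
  - by rewrite !mulr_ge0 ?powR_ge0 ?expR_ge0.
  - by rewrite mulr_ge0 ?powR_ge0 ?expR_ge0.
  rewrite (_ : K * _ = (2 * (x - 1 + 1)) `^ (x - 1) * expR (- (1 / 2) * t)); last by rewrite /K; field.
  exact: powR_expR_le.
- by move=> t _; rewrite mulr_ge0 ?powR_ge0 ?expR_ge0.
- by move=> t /=; rewrite !in_itv/= andbT => /andP[t1 _]; exact: lt_le_trans t1.
- move=> t /=; rewrite in_itv/= => /andP[t1 _].
  by rewrite mulr_gt0 ?expR_gt0// powR_gt0//; exact: lt_le_trans t1.
- have l0 : (0 < lam `[1%R, 2%R]%classic)%E.
    by rewrite lebesgue_measure_itv/= lte_fin ifT ?lte_fin; lra.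
  exact: l0.
Qed.

Lemma gamma_gt0 m : 0 < gamma alpha m.
Proof.
have m0 : 0 <= m%:R :> R by [].
rewrite /gamma sqrtr_gt0 divr_gt0// ?mulr_gt0// Gamma_gt0//; move: m0 alpha_gt; lra.
Qed.

End GammaPos.

(** * Operators on monomials *)

Section Commute.
Context {R : realType}.
Local Notation C := R[i].
Local Notation "x %:C" := (real_complex R x).
Variable alpha : R.
Hypothesis alpha_gt : -1 < alpha.
Implicit Types (f F G : C -> C) (chi : R -> R) (l i : nat).

Local Notation bg := (bergman alpha).
Local Notation gam m := ((gamma alpha m)%:C).
Implicit Types (a b : int -> C) (j M N : nat) (u : nat -> {poly C}) (q : {poly C}).

Lemma gam_neq0 m : gam m != 0.
Proof. by rewrite eq_complex/= negb_and gt_eqF// gamma_gt0. Qed.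

(** The linear map on polynomials that sends ['X^m] to [u m]. *)
Definition lin_ext u q := \sum_(m < size q) q`_m *: u m.

Lemma lin_widen u q N : (size q <= N)%N -> lin_ext u q = \sum_(m < N) q`_m *: u m.
Proof.
move=> qN; rewrite /lin_ext (big_ord_widen _ (fun m => q`_m *: u m) qN) big_mkcond/=.
apply: eq_bigr => m _; case: ltnP => // h.
by rewrite nth_default// scale0r.
Qed.

Lemma linB u q q' c : lin_ext u (q - c *: q') = lin_ext u q - c *: lin_ext u q'.
Proof.
pose N := maxn (size (q - c *: q')) (maxn (size q) (size q')).
have h1 : (size (q - c *: q')%R <= N)%N by rewrite leq_maxl.
have h2 : (size q <= N)%N by rewrite /N !leq_max leqnn orbT.
have h3 : (size q' <= N)%N by rewrite /N !leq_max leqnn !orbT.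
rewrite (lin_widen u h1) (lin_widen u h2) (lin_widen u h3) scaler_sumr -sumrB.
by apply: eq_bigr => m _; rewrite coefB coefZ scalerBl scalerA.
Qed.

Lemma coef_lin u q N : (lin_ext u q)`_N = \sum_(m < size q) q`_m * (u m)`_N.
Proof. by rewrite /lin_ext coef_sum; apply: eq_bigr => m _; rewrite coefZ. Qed.

Lemma pol_sum I (r : seq I) (P : pred I) (F : I -> {poly C}) :
  disc_poly (\sum_(i <- r | P i) F i) = fun z => \sum_(i <- r | P i) disc_poly (F i) z.
Proof.
apply/funext => z; elim: r => [|i r IH]; first by rewrite !big_nil pol0.
by rewrite !big_cons; case: ifP => _ //; rewrite polD IH.
Qed.
 
Lemma isproj_sum N (G H : nat -> C -> C) : (forall m, (m < N)%N -> is_proj alpha (G m) (H m)) ->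
  is_proj alpha (fun z => \sum_(m < N) G m z) (fun z => \sum_(m < N) H m z).
Proof.
elim: N => [_|N IH GH].
  under eq_fun do rewrite big_ord0; under [X in is_proj _ _ X]eq_fun do rewrite big_ord0.
  exact: isproj0.
under eq_fun do rewrite big_ord_recr; under [X in is_proj _ _ X]eq_fun do rewrite big_ord_recr.
apply: isprojD => //; last exact: GH.
by apply: IH => m mN; apply: GH; exact: ltnW.
Qed.

Section symbols.
Variable n : nat.
Local Notation idx j := (j%:Z - n%:Z)%R.

Lemma harmonic_monomialE j z : harmonic_monomial alpha (idx j) z =
  (if (n <= j)%N then z ^+ (j - n) else conjc z ^+ (n - j)) / gam `|idx j|%N.
Proof.
case: leqP => nj; first by rewrite subzn.
have nj0 : (0 < n - j)%N by rewrite subn_gt0.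
have -> : idx j = Negz (n - j).-1.
  by rewrite NegzE (prednK nj0) -(subzn (ltnW nj)) opprB.
by rewrite /harmonic_monomial (prednK nj0).
Qed.

(** The coefficient of [z^(m+i)] in the Toeplitz image of [z^m], for [i = j - n]. Indices are
    shifted by [n] to run over naturals; the truncated subtractions here and in [toeplitz_mon] are
    exact once [n <= m]. *)
Definition tcoef a j m : C := a (idx j) / gam `|idx j|%N *
  (if (n <= j)%N then 1 else (moment_ratio alpha (m - (n - j)) (n - j))%:C).

Definition toeplitz_mon a m : {poly C} := \sum_(j < (n.*2).+1) tcoef a j m *: 'X^(m + j - n).

Lemma tcoef_neq0 a j m : a (idx j) != 0 -> tcoef a j m != 0.
Proof.
move=> aj; rewrite mulf_neq0 ?mulf_neq0 ?invr_neq0 ?gam_neq0//.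
case: ifP => _; first exact: oner_neq0.
by rewrite eq_complex/= negb_and gt_eqF// mratio_gt0.
Qed.

Lemma isproj_tmon a m : (n <= m)%N ->
  is_proj alpha (fun z => harmonic_poly alpha n a z * disc_poly 'X^m z) (disc_poly (toeplitz_mon a m)).
Proof.
move=> nm; rewrite /toeplitz_mon pol_sum /harmonic_poly.
under eq_fun do rewrite mulr_suml.
apply: (@isproj_sum _ (fun j z => a (idx j) * harmonic_monomial alpha (idx j) z * disc_poly 'X^m z)
  (fun j => disc_poly (tcoef a j m *: 'X^(m + j - n)))) => j _.
rewrite polZ /tcoef; set c := a _ / _.
have -> : (fun z => a (idx j) * harmonic_monomial alpha (idx j) z * disc_poly 'X^m z) =
  fun z => c * ((if (n <= j)%N then z ^+ (j - n) else conjc z ^+ (n - j)) * disc_poly 'X^m z).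
  by apply/funext => z; rewrite harmonic_monomialE /c; ring.
case: leqP => nj.
  rewrite mulr1; apply: isprojZ => //.
  rewrite (_ : (m + j - n = j - n + m)%N); last by rewrite addnC addnBAC.
  exact: isproj_mulX.
have -> : (m + j - n = m - (n - j))%N by rewrite subnBA// ltnW.
have mE : m = (m - (n - j) + (n - j))%N by rewrite subnK// (leq_trans (leq_subr _ _)).
rewrite (_ : (fun z => c * _ * _) = fun z => c * disc_poly ((moment_ratio alpha (m - (n - j)) (n - j))%:C *: 'X^(m - (n - j))) z).
  by apply: isprojZ => //; rewrite {1}mE; exact: isproj_mulJX.
by apply/funext => z; rewrite polZ mulrA.
Qed.

Lemma pol_coefs q : disc_poly q = fun z => \sum_(m < size q) q`_m * disc_poly 'X^m z.
Proof.
rewrite -[in LHS](coefK q) poly_def pol_sum; apply/funext => z.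
by apply: eq_bigr => m _; rewrite polZ.
Qed.

Lemma pol_lin u q : disc_poly (lin_ext u q) = fun z => \sum_(m < size q) q`_m * disc_poly (u m) z.
Proof.
by rewrite /lin_ext pol_sum; apply/funext => z; apply: eq_bigr => m _; rewrite polZ.
Qed.

(** Degrees below [n] are excluded because there [zbar^i z^m] with [i > m] may occur, to which the
    formula of [toeplitz_mon] does not apply. *)
Lemma toeplitz_pol a q : (forall m, (m < n)%N -> q`_m = 0) ->
  toeplitz alpha (harmonic_poly alpha n a) (disc_poly q) = disc_poly (lin_ext (toeplitz_mon a) q).
Proof.
move=> q0; apply: isprojE => //; rewrite pol_lin (pol_coefs q).
under eq_fun do rewrite mulr_sumr.
apply: (@isproj_sum _ (fun m z => harmonic_poly alpha n a z * (q`_m * disc_poly 'X^m z))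
  (fun m z => q`_m * disc_poly (toeplitz_mon a m) z)) => m _.
rewrite (_ : (fun z => harmonic_poly alpha n a z * _) =
  fun z => q`_m * (harmonic_poly alpha n a z * disc_poly 'X^m z)); last first.
  by apply/funext => z; ring.
have [mn|nm] := ltnP m n; last by apply: isprojZ => //; exact: isproj_tmon.
rewrite q0//; under eq_fun do rewrite mul0r; under [X in is_proj _ _ X]eq_fun do rewrite mul0r.
exact: isproj0.
Qed.

Lemma coef_tmon a m j : (n <= m)%N -> (j <= n.*2)%N -> (toeplitz_mon a m)`_(m + j - n) = tcoef a j m.
Proof.
move=> nm jn; rewrite coef_sum (bigD1 (inord j))//= inordK// coefZ coefXn eqxx mulr1.
rewrite big1 ?addr0// => i; rewrite -val_eqE/= inordK// => ij.
rewrite coefZ coefXn -!addnBAC// eqn_add2l eq_sym (negbTE ij) mulr0//.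
Qed.

Lemma coef_tmon_neq0 a m N : (n <= m)%N -> (toeplitz_mon a m)`_N != 0 ->
  exists j, [/\ (j <= n.*2)%N, (N + n = m + j)%N & a (idx j) != 0].
Proof.
move=> nm; rewrite coef_sum => /eqP s0.
have [j /andP[/eqP Nj aj]|h] := pickP (fun j : 'I_(n.*2).+1 => (N == m + j - n)%N && (a (idx j) != 0)).
  exists j; split => //; first by rewrite -ltnS.
  by rewrite Nj subnK// (leq_trans nm)// leq_addr.
exfalso; apply: s0; rewrite big1// => j _; rewrite coefZ coefXn.
have := h j; case: eqP => //= _; last by rewrite mulr0.
by move=> /negbFE/eqP aj; rewrite /tcoef aj !mul0r.
Qed.

Lemma tmonB a b c m : toeplitz_mon (fun i : int => b i - c * a i) m = toeplitz_mon b m - c *: toeplitz_mon a m.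
Proof.
rewrite /toeplitz_mon scaler_sumr -sumrB; apply: eq_bigr => j _.
by rewrite scalerA -scalerBl /tcoef; congr (_ *: _); ring.
Qed.

End symbols.

Section shift.
Variables (k : nat) (W : (C -> C) -> C -> C).
Hypothesis k2 : (2 <= k)%N.
Hypothesis HW : is_slant_shift alpha k W.

(** The factor [gam m / gam (m %/ k)] converts from the orthonormal basis to monomials. *)
Definition shift_mon m : {poly C} :=
  if (k %| m)%N then (gam m / gam (m %/ k)%N) *: 'X^(m %/ k) else 0.

Lemma W_comb c f g : bg f -> bg g -> W (fun z => c * f z + g z) = fun z => c * W f z + W g z.
Proof. by move=> bf bg'; case: HW => -[_ H _] _; exact: H. Qed.

Lemma W_bg f : bg f -> bg (W f).
Proof. by move=> bf; case: HW => -[H _ _] _; exact: H. Qed.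

Lemma W0 : W (fun=> 0) = fun=> 0.
Proof.
have b0 := bergman0 alpha_gt.
have := W_comb 1 b0 b0; rewrite (_ : (fun z => 1 * 0 + 0) = fun=> 0); last first.
  by apply/funext => z; rewrite mulr0 addr0.
move=> E; apply/funext => z; have /= := congr1 (@^~ z) E; set y := W _ z.
by rewrite mul1r => /(congr1 (fun x => x - y)); rewrite addrK subrr.
Qed.

Lemma WZ c f : bg f -> W (fun z => c * f z) = fun z => c * W f z.
Proof.
move=> bf; have := W_comb c bf (bergman0 alpha_gt); rewrite W0.
by under eq_fun do rewrite addr0; under [RHS]eq_fun do rewrite addr0.
Qed.

Lemma W_polX m : W (disc_poly 'X^m) = disc_poly (shift_mon m).
Proof.
have basis i : bergman_basis alpha i = fun z => (gam i)^-1 * disc_poly 'X^i z.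
  by apply/funext => z; rewrite /bergman_basis /disc_poly; case: ifP => _; rewrite ?mulr0// hornerXn mulrC.
have polE' : disc_poly 'X^m = fun z => gam m * bergman_basis alpha m z.
  by apply/funext => z; rewrite basis mulrA mulfV ?gam_neq0// mul1r.
rewrite [in LHS]polE' WZ; last by rewrite basis; apply: bergmanZ => //; exact: bergman_pol.
have [_ ->] := HW; rewrite /shift_mon; case: ifP => _; last by rewrite pol0; apply/funext => z; rewrite mulr0.
by rewrite basis polZ; apply/funext => z; rewrite mulrA.
Qed.

Lemma W_sum N (q : nat -> C) (F : nat -> C -> C) : (forall m, bg (F m)) ->
  W (fun z => \sum_(m < N) q m * F m z) = (fun z => \sum_(m < N) q m * W (F m) z) /\
  bg (fun z => \sum_(m < N) q m * F m z).
Proof.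
move=> bF; elim: N => [|N [IH bN]].
  under eq_fun do rewrite big_ord0.
  by split; [rewrite W0; apply/funext => z; rewrite big_ord0|exact: bergman0].
have E : (fun z => \sum_(m < N.+1) q m * F m z) =
    fun z => q N * F N z + \sum_(m < N) q m * F m z.
  by apply/funext => z; rewrite big_ord_recr addrC.
rewrite E; split; last exact: bergman_comb.
by rewrite W_comb// IH; apply/funext => z; rewrite big_ord_recr addrC.
Qed.

Lemma W_pol q : W (disc_poly q) = disc_poly (lin_ext shift_mon q).
Proof.
rewrite pol_lin (pol_coefs q).
have [-> _] := @W_sum (size q) (fun m => q`_m) (fun m => disc_poly 'X^m) (fun m => bergman_pol alpha_gt _).
by apply/funext => z; apply: eq_bigr => m _; rewrite W_polX.
Qed.

(** Only the exponent [k * N] is sent to [N], and its factor is nonzero; so the shift preserves the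
    pattern of vanishing coefficients. *)
Lemma coef_lin_wmon q N : (lin_ext shift_mon q)`_N = q`_(k * N) * (gam (k * N)%N / gam N).
Proof.
have k0 : (0 < k)%N by exact: ltnW.
have wE m : (shift_mon m)`_N = if m == (k * N)%N then gam (k * N)%N / gam N else 0.
  rewrite /shift_mon; case: eqP => [->|mN].
    by rewrite dvdn_mulr// mulKn// coefZ coefXn eqxx mulr1.
  case: ifP => [kd|_]; last by rewrite coef0.
  rewrite coefZ coefXn; case: eqP => [NE|_]; last by rewrite mulr0.
  by exfalso; apply: mN; rewrite NE mulnC divnK.
rewrite coef_lin; have [h|h] := ltnP (k * N)%N (size q); last first.
  rewrite nth_default// mul0r big1// => m _; rewrite wE ifF ?mulr0//.
  by apply/negP => /eqP mE; move: (ltn_ord m); rewrite mE ltnNge h.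
rewrite (bigD1 (Ordinal h))//= wE eqxx big1 ?addr0// => m.
by rewrite -val_eqE/= wE => /negbTE ->; rewrite mulr0.
Qed.

Section commute.
Variables (n : nat) (a b : int -> C).
Local Notation idx j := (j%:Z - n%:Z)%R.

Definition slant_mon2 a b m := lin_ext shift_mon (lin_ext (toeplitz_mon n a) (lin_ext shift_mon (toeplitz_mon n b m))).

(** The first symbol lowers [m] by at most [n], so all exponents are at least [k * n]; after
    division by [k] they are at least [n], as [toeplitz_pol] asks for the second symbol. *)
Lemma slant_slant_polX a1 b1 m : (n + k * n <= m)%N ->
  slant_toeplitz alpha W (harmonic_poly alpha n a1)
    (slant_toeplitz alpha W (harmonic_poly alpha n b1) (disc_poly 'X^m)) = disc_poly (slant_mon2 a1 b1 m).
Proof.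
move=> nm; have nm' : (n <= m)%N by rewrite (leq_trans _ nm)// leq_addr.
have k0 : (0 < k)%N by exact: ltnW.
have E : lin_ext (toeplitz_mon n b1) 'X^m = toeplitz_mon n b1 m.
  rewrite /lin_ext size_polyXn big_ord_recr/= coefXn eqxx scale1r big1 ?add0r// => i _.
  by rewrite coefXn ltn_eqF ?scale0r.
rewrite /slant_toeplitz toeplitz_pol; last first.
  by move=> i im; rewrite coefXn ltn_eqF// (leq_trans im).
rewrite E W_pol toeplitz_pol ?W_pol// => M Mn.
apply/eqP/negPn/negP; rewrite coef_lin_wmon mulf_eq0 negb_or => /andP[/(coef_tmon_neq0 nm')[j [jn e _]] _].
have : (k * M < k * n)%N by rewrite ltn_pmul2l.
by move: nm e; lia.
Qed.

Hypothesis comm : forall m, (n + k * n <= m)%N -> slant_mon2 a b m = slant_mon2 b a m.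
Hypothesis an : a n%:Z != 0.

(* The contradiction is read off the coefficient of [z^p] in the images of [z^m]:
   here [T = t + n], where [t] is the top index of [b' = b - c a], and
   [M0 = k p - n], [m = k M0 - t]. *)
Lemma commute_proportional j : (j <= n.*2)%N -> b (idx j) = b n%:Z / a n%:Z * a (idx j).
Proof.
move=> jn; pose c := b n%:Z / a n%:Z; pose b' (i : int) := b i - c * a i.
have k0 : (0 < k)%N by exact: ltnW.
have idxn : idx n.*2 = n%:Z by rewrite -addnn PoszD addrK.
have b'n : b' n%:Z = 0 by rewrite /b' /c divfK// subrr.
have tb M : toeplitz_mon n b' M = toeplitz_mon n b M - c *: toeplitz_mon n a M by exact: tmonB.
have linb' q : lin_ext (toeplitz_mon n b') q = lin_ext (toeplitz_mon n b) q - c *: lin_ext (toeplitz_mon n a) q.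
  rewrite /lin_ext scaler_sumr -sumrB; apply: eq_bigr => M _.
  by rewrite tb scalerBr !scalerA (mulrC c).
(* Passing from [b] to [b - c a] subtracts on both sides the same multiple of the product of [a]
   with itself. *)
have comm' m : (n + k * n <= m)%N -> slant_mon2 a b' m = slant_mon2 b' a m.
  by move=> /comm; rewrite /slant_mon2 linb' tb !linB => ->.
suff b0 : forall j, (j <= n.*2)%N -> b' (idx j) = 0.
  by apply/eqP; rewrite -subr_eq0; apply/eqP; exact: b0.
move=> {j jn} j jn; apply/eqP/negPn/negP => bj.
have ex : exists j, (j <= n.*2)%N && (b' (idx j) != 0) by exists j; rewrite jn.
have bd i : (i <= n.*2)%N && (b' (idx i) != 0) -> (i <= n.*2)%N by case/andP.
case: (ex_maxnP ex bd) => T /andP[Tn bT] Tmax.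
have {}Tn : (T < n.*2)%N.
  rewrite ltn_neqAle Tn andbT; apply: contraNneq bT => ->.
  by rewrite idxn b'n.
have n0 : (0 < n)%N by case: (n) Tn.
(* With [k >= 2], [p = 3 n] gives [M0 >= 5 n], enough for [m >= n + k n] whatever [T < 2 n] is. *)
pose p := (3 * n)%N; pose M0 := (k * p - n)%N; pose m := (k * M0 + n - T)%N.
have kp : (2 * p <= k * p)%N by rewrite leq_mul2r k2 orbT.
have M0n : (5 * n <= M0)%N by rewrite /M0 /p; move: kp; rewrite /p; lia.
have kM0 : (2 * M0 <= k * M0)%N by rewrite leq_mul2r k2 orbT.
have kM0' : (k * (5 * n) <= k * M0)%N by rewrite leq_pmul2l.
have kn2 : (2 * n <= k * n)%N by rewrite leq_mul2r k2 orbT.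
have mbig : (n + k * n <= m)%N.
  by rewrite /m; move: kM0' Tn kn2; rewrite mulnCA; lia.
have mE : (m + T = k * M0 + n)%N by rewrite /m subnK//; lia.
have nm : (n <= m)%N by rewrite (leq_trans _ mbig)// leq_addr.
have nM0 : (n <= M0)%N by lia.
have M0E : (M0 + n = k * p)%N by rewrite /M0 subnK// /p; lia.
clearbody m M0 p.
have := congr1 (fun r : {poly C} => r`_p) (comm' m mbig).
rewrite /slant_mon2 !coef_lin_wmon => /(mulIf (mulf_neq0 (gam_neq0 _) (invr_neq0 (gam_neq0 _)))).
rewrite !coef_lin.
set q := lin_ext shift_mon (toeplitz_mon n b' m); set q' := lin_ext shift_mon (toeplitz_mon n a m).
(* The exponents [m + i - n] with [i <= T] lie between [k n] and [k M0]; divide by [k]. *)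
have qn M : q`_M != 0 -> (n <= M)%N /\ (M <= M0)%N.
  rewrite /q coef_lin_wmon mulf_eq0 negb_or => /andP[/(coef_tmon_neq0 nm)[i [hi e bi]] _].
  have iT : (i <= T)%N by apply: Tmax; rewrite hi.
  split; rewrite leqNgt; apply/negP => h.
    have : (k * M < k * n)%N by rewrite ltn_pmul2l.
    by move: e mbig; lia.
  have : (k * M0 < k * M)%N by rewrite ltn_pmul2l.
  by move: e mE iT; lia.
have qM0 : q`_M0 != 0.
  rewrite /q coef_lin_wmon mulf_neq0 ?mulf_neq0 ?invr_neq0 ?gam_neq0//.
  rewrite (_ : (k * M0 = m + T - n)%N); last by rewrite mE addnK.
  by rewrite coef_tmon//; [exact: tcoef_neq0|exact: ltnW].
have M0q : (M0 < size q)%N.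
  by rewrite ltnNge; apply: contra qM0 => h; rewrite nth_default.
(* The outer symbol raises exponents by at most [n], so among [M <= M0] only [M0] reaches
   [k p = M0 + n]. *)
rewrite (bigD1 (Ordinal M0q))//= big1 ?addr0; last first.
  move=> M; rewrite -val_eqE/= => MM0; apply/eqP; rewrite mulf_eq0.
  have [//|qM] := eqVneq q`_M 0; have [nM MM] := qn _ qM => /=.
  apply/negPn/negP => /(coef_tmon_neq0 nM)[i [hi e _]].
  have : (M < M0)%N by rewrite ltn_neqAle MM0.
  by move: e M0E hi; rewrite -addnn; lia.
(* In the other order, reaching [k p] with an outer index at most [T - n] forces
   [M >= M0 + (2 n - T)]. But [k M <= m + n = k M0 + (2 n - T)], impossible since [k >= 2] and
   [T < 2 n]. *)
rewrite [RHS]big1; last first.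
  move=> M _; apply/eqP; rewrite mulf_eq0.
  have [//|] := eqVneq q'`_M 0; rewrite /q' coef_lin_wmon mulf_eq0 negb_or.
  move=> /andP[/(coef_tmon_neq0 nm)[i [hi e _]] _] /=.
  have nM : (n <= M)%N.
    rewrite leqNgt; apply/negP => h; have : (k * M < k * n)%N by rewrite ltn_pmul2l.
    by move: e mbig; move: (k * M)%N (k * n)%N => x y; lia.
  apply/negPn/negP => /(coef_tmon_neq0 nM)[i' [hi' e' bi']].
  have iT : (i' <= T)%N by apply: Tmax; rewrite hi'.
  have MM : (M0 + (n.*2 - T) <= M)%N by lia.
  have : (k * (M0 + (n.*2 - T)) <= k * M)%N by rewrite leq_pmul2l.
  have : (2 * (n.*2 - T) <= k * (n.*2 - T))%N by rewrite leq_mul2r k2 orbT.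
  rewrite mulnDr; move: e hi mE Tn.
  by move: (k * M)%N (k * M0)%N (k * _)%N => x y z; lia.
(* What survives is the coefficient of [q] at [M0] times the top coefficient of [a], both
   nonzero. *)
move=> /eqP; rewrite mulf_eq0 (negbTE qM0)/=.
rewrite (_ : (k * p = M0 + n.*2 - n)%N); last by rewrite -addnn addnA addnK M0E.
rewrite coef_tmon// => /eqP t0; move: (@tcoef_neq0 n a n.*2 M0); rewrite t0 eqxx idxn => /(_ an).
by [].
Qed.

End commute.
End shift.
End Commute.

(** * Commutation *)

Section Dependent.
Context {R : realType}.
Local Notation C := R[i].
Variables (alpha : R) (k n : nat) (W : (C -> C) -> C -> C).
Hypothesis alpha_gt : -1 < alpha.
Hypothesis HW : is_slant_shift alpha k W.
Implicit Types (a b : int -> C) (f phi psi : C -> C).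
Local Notation bg := (bergman alpha).
Local Notation B := (slant_toeplitz alpha W).

Lemma L2_sum N (F : nat -> C -> C) : (forall m, L2 alpha (F m)) ->
  L2 alpha (fun z => \sum_(m < N) F m z).
Proof.
move=> LF; elim: N => [|N IH].
  by under eq_fun do rewrite big_ord0; exact: L2_0.
by under eq_fun do rewrite big_ord_recr; exact: L2D.
Qed.

Lemma L2_harmonic_mul a f : L2 alpha f -> L2 alpha (fun z => harmonic_poly alpha n a z * f z).
Proof.
move=> Lf; rewrite /harmonic_poly; under eq_fun do rewrite mulr_suml.
apply: (@L2_sum _ (fun j z => a (j%:Z - n%:Z) * harmonic_monomial alpha (j%:Z - n%:Z) z * f z)) => j.
set i := j%:Z - n%:Z.
have -> : (fun z => a i * harmonic_monomial alpha i z * f z) = fun z => a i / (gamma alpha `|i|%N)%:C%C *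
    ((if (n <= j)%N then z ^+ (j - n) else conjc z ^+ (n - j)) * f z).
  by apply/funext => z; rewrite harmonic_monomialE; ring.
by apply: L2Z => //; case: (n <= j)%N; [exact: L2_mulX|exact: L2_mulJX].
Qed.

Lemma slant_bg phi f : bg (B phi f).
Proof. by apply: (W_bg HW); exact: bergman_proj_bg. Qed.

Lemma toeplitz_scale phi psi c f : (forall g, bg g -> L2 alpha (fun z => phi z * g z)) ->
  (forall z, unit_disc z -> psi z = c * phi z) -> bg f ->
  toeplitz alpha psi f = fun z => c * toeplitz alpha phi f z.
Proof.
move=> Lphi psiE bf; rewrite /toeplitz -bergman_projZ//; last exact: Lphi.
(* The symbols are proportional on the disc only; off it [f] vanishes, so the products still agree
   as total functions. *)
congr bergman_proj; apply/funext => z; have [uz|nuz] := pselect (unit_disc z).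
  by rewrite psiE// mulrA.
by case: bf => f0 _ _; rewrite f0// !mulr0.
Qed.

Lemma slant_scale phi psi c f : (forall g, bg g -> L2 alpha (fun z => phi z * g z)) ->
  (forall z, unit_disc z -> psi z = c * phi z) -> bg f ->
  B psi f = fun z => c * B phi f z.
Proof.
move=> Lphi psiE bf; rewrite /slant_toeplitz (toeplitz_scale Lphi psiE bf).
by rewrite (WZ alpha_gt HW)//; exact: bergman_proj_bg.
Qed.

Lemma toeplitzZ phi c f : (forall g, bg g -> L2 alpha (fun z => phi z * g z)) -> bg f ->
  toeplitz alpha phi (fun z => c * f z) = fun z => c * toeplitz alpha phi f z.
Proof.
move=> Lphi bf; rewrite /toeplitz -bergman_projZ//; last exact: Lphi.
by congr bergman_proj; apply/funext => z; ring.
Qed.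

(** Both sides equal [c] times the square of the operator of [phi] applied to [f]. *)
Lemma proportional_commute phi psi c f : (forall g, bg g -> L2 alpha (fun z => phi z * g z)) ->
  (forall z, unit_disc z -> psi z = c * phi z) -> bg f ->
  B phi (B psi f) = B psi (B phi f).
Proof.
move=> Lphi psiE bf; have b1 := slant_bg phi f.
rewrite (slant_scale Lphi psiE bf) (slant_scale Lphi psiE b1).
rewrite {1}/slant_toeplitz toeplitzZ//.
by rewrite (WZ alpha_gt HW)//; exact: bergman_proj_bg.
Qed.

End Dependent.

Theorem theorem3p1 (R : realType) (alpha : R) (k n : nat) (a b : int -> R[i])
    (W : (R[i] -> R[i]) -> (R[i] -> R[i])) :
  -1 < alpha ->
  (2 <= k)%N ->
  a n%:Z != 0 ->
  b n%:Z != 0 ->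
  is_slant_shift alpha k W ->
  let phi := harmonic_poly alpha n a in
  let psi := harmonic_poly alpha n b in
  (forall f, bergman alpha f ->
     slant_toeplitz alpha W phi (slant_toeplitz alpha W psi f) =
     slant_toeplitz alpha W psi (slant_toeplitz alpha W phi f)) <->
  linearly_dependent phi psi.
Proof.
move=> alpha_gt k2 an bn HW phi psi; split=> [comm|[c [d [cd0 cd]]] f bf].
  (* Commutation is tested on monomials of large degree, and [pol_inj] turns the equality of
     functions into one of polynomials. *)
  have H m : (n + k * n <= m)%N ->
      slant_mon2 alpha k n a b m = slant_mon2 alpha k n b a m.
    move=> nm; apply: (@pol_inj R).
    have E := fun a1 b1 => slant_slant_polX alpha_gt k2 HW a1 b1 nm.
    by rewrite -(E a b) -(E b a); apply: comm; exact: bergman_pol.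
  exists (- (b n%:Z / a n%:Z)), 1; split; first by rewrite xpair_eqE oner_eq0 andbF.
  move=> z _; rewrite mul1r /phi /psi /harmonic_poly mulr_sumr -big_split big1// => j _ /=.
  rewrite (commute_proportional alpha_gt k2 H an); first by ring.
  by rewrite -ltnS.
have Lphi g : bergman alpha g -> L2 alpha (fun z => phi z * g z).
  by move=> [_ _ Lg]; exact: L2_harmonic_mul.
have Lpsi g : bergman alpha g -> L2 alpha (fun z => psi z * g z).
  by move=> [_ _ Lg]; exact: L2_harmonic_mul.
(* If [d = 0], then [phi] vanishes on the disc, so [phi = 0 * psi] and the roles are exchanged;
   otherwise [psi = (- c / d) * phi]. *)
have [d0|d0] := eqVneq d 0.
  have c0 : c != 0 by move: cd0; rewrite xpair_eqE d0 eqxx andbT.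
  apply/esym; apply: (proportional_commute alpha_gt HW Lpsi (c := 0)) => // z uz.
  have := cd z uz; rewrite d0 mul0r addr0 => /eqP; rewrite mulf_eq0 (negbTE c0)/=.
  by move=> /eqP ->; rewrite ?mul0r.
apply: (proportional_commute alpha_gt HW Lphi (c := - c / d)) => // z uz.
have := cd z uz; rewrite addrC => /eqP; rewrite addr_eq0 => /eqP E.
by apply: (mulfI d0); rewrite E mulrA mulrCA mulfV// mulr1 mulNr.
Qed.
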